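(* There exist ergodic flows which are not approximately transitive (AT) and do not satisfy Property B.
   Context: A (measurable) flow on a standard $\sigma$-finite measure space $(X,\mathfrak{B},\mu)$ is a one-parameter group $\{F_t\}_{t\in\mathbb{R}}$ of nonsingular automorphisms of $(X,\mathfrak{B},\mu)$ such that $X\times\mathbb{R}\ni(x,t)\mapsto F_t(x)\in X$ is measurable. It is ergodic if every $F_t$-invariant measurable set is null or conull. Property B: for $A\in\mathfrak{B}$ of positive measure and $s,\delta>0$ let $\Lambda_{F,\delta,s}(A)=\{x\in A:\ \exists t\in(e^{s-\delta},e^{s+\delta})\cup(-e^{s+\delta},-e^{s-\delta}),\ F_t(x)\in A\}$. The flow has Property B if there exists a measurable set $A\subseteq X$ of positive measure such that for all $\delta>0$, $\limsup_{s\to\infty}\mu(\Lambda_{F,\delta,s}(A))=0$. Approximate transitivity (AT, Connes–Woods): the flow is approximately transitive if for every $n\ge1$, all $f_1,\dots,f_n\in L^1_+(X,\mu)$ and every $\varepsilon>0$, there exist $f\in L^1_+(X,\mu)$, $m\ge 1$, $t_1,\dots,t_m\in\mathbb{R}$ and $\lambda_{jk}\ge0$ ($1\le j\le n$, $1\le k\le m$) such that $\left\|f_j-\sum_{k=1}^m\lambda_{jk}\,(f\circ F_{t_k})\,\frac{d\mu\circ F_{t_k}}{d\mu}\right\|_1\le\varepsilon$ for $j=1,\dots,n$. *)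

(* Defs.v *)
From HB Require Import structures.
From mathcomp Require Import all_boot all_order all_algebra.
From mathcomp Require Import all_classical all_reals all_analysis.
From mathcomp Require Import measurable_realfun.

Set Implicit Arguments.
Unset Strict Implicit.
Unset Printing Implicit Defensive.

Import Order.TTheory GRing.Theory Num.Theory.
Import numFieldNormedType.Exports.
Local Open Scope classical_set_scope.
Local Open Scope ring_scope.

(* The sigma-algebra of T is the Borel sigma-algebra of a Polish topology,
   carried to T by a bijection. A complete pseudometric structure is completely
   metrizable once it is Hausdorff, and for such a space separability and second
   countability agree. *)
Definition standard_borel (R : realType) d (T : measurableType d) : Prop :=
  exists (P : completePseudoMetricType R) (phi : T -> P),
    [/\ hausdorff_space P, @second_countable P, bijective phi &
        (measurable : set (set T)) =
          [set phi @^-1` B | B in <<s (@open P) >>]].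

Section flows.
Context d (T : measurableType d) (R : realType).
Variable mu : {measure set T -> \bar R}.

Record nonsingular_automorphism (f : T -> T) : Prop := {
  nsa_bijective : bijective f ;
  nsa_measurable : measurable_fun [set: T] f ;
  nsa_measurable_inv : forall A, measurable A -> measurable (f @` A) ;
  nsa_nonsingular : forall A, measurable A ->
    (mu (f @^-1` A) = 0%E <-> mu A = 0%E) }.

Record is_flow (F : R -> T -> T) : Prop := {
  flow_automorphism : forall t, nonsingular_automorphism (F t) ;
  flow0 : forall x, F 0 x = x ;
  flowD : forall s t x, F (s + t) x = F s (F t x) ;
  flow_measurable :
    measurable_fun [set: T * measurableTypeR R] (fun p => F p.2 p.1) }.

(* [F t @^-1` A = A] holds everywhere, not only up to a null set; for
   measurable flows on standard spaces the two readings define the same notion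
   of ergodicity. *)
Definition ergodic (F : R -> T -> T) : Prop :=
  forall A, measurable A -> (forall t, F t @^-1` A = A) ->
    mu A = 0%E \/ mu (~` A) = 0%E.

Definition Lambda (F : R -> T -> T) (delta s : R) (A : set T) : set T :=
  [set x | A x /\ exists2 t,
    (`]expR (s - delta), expR (s + delta)[ `|`
     `]- expR (s + delta), - expR (s - delta)[) t & A (F t x)].

(* [Lambda F delta s A] is a projection of a Borel set, hence analytic but not
   Borel in general. It is measurable for the completion of [mu], whose value
   on it is that of the outer measure [mu_ext mu]. *)
Definition property_B (F : R -> T -> T) : Prop :=
  exists A, [/\ measurable A, (0 < mu A)%E &
    forall delta : R, 0 < delta ->
      limf_esup (fun s : R => mu_ext mu (Lambda F delta s A)) +oo%R = 0%E].

(* Elements of L^1_+ are given by everywhere nonnegative representatives. *)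
Definition L1_nonneg (f : T -> R) : Prop :=
  mu.-integrable [set: T] (EFin \o f) /\ forall x, 0 <= f x.

Definition is_RN_derivative (nu : set T -> \bar R) (g : T -> \bar R) : Prop :=
  [/\ measurable_fun [set: T] g, forall x, (0 <= g x)%E &
      forall A, measurable A -> nu A = (\int[mu]_(x in A) g x)%E].

(* The library's Radon-Nikodym derivative is restricted to a finite [nu], while
   [mu \o F_t] is only sigma-finite. A derivative exists whenever [mu] and [nu]
   are sigma-finite measures with [nu] dominated by [mu], and is unique
   [mu]-almost everywhere; the default value [cst 0] is then not used. *)
Definition RN_derivative (nu : set T -> \bar R) : T -> \bar R :=
  xget (cst 0%E) [set g | is_RN_derivative nu g].

(* [RN_derivative (fun A => mu (F t @` A))] is d(mu \o F_t)/dmu, where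
   [(mu \o F_t)(A)] is the measure of the image of [A], not of its preimage. *)
Definition approximately_transitive (F : R -> T -> T) : Prop :=
  forall (n : nat) (f_ : 'I_n -> T -> R) (eps : R),
    (0 < n)%N -> (forall j, L1_nonneg (f_ j)) -> 0 < eps ->
  exists (f : T -> R) (m : nat) (t : 'I_m -> R) (lambda : 'I_n -> 'I_m -> R),
    [/\ L1_nonneg f, (0 < m)%N, (forall j k, 0 <= lambda j k) &
      forall j, (Lnorm mu 1 (fun x => (f_ j x)%:E -
        \sum_(k < m) (lambda j k)%:E * ((f (F (t k) x))%:E *
          RN_derivative (fun A => mu (F (t k) @` A)) x)) <= eps%:E)%E].

End flows.

(* Main.v *)
Require Import Defs.
From mathcomp Require Import all_boot all_order all_algebra.
From mathcomp Require Import all_classical all_reals all_analysis.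
From mathcomp Require Import measurable_realfun.
From mathcomp Require Import ring lra zify.

Set Implicit Arguments.
Unset Strict Implicit.
Unset Printing Implicit Defensive.

Import Order.TTheory GRing.Theory Num.Theory.
Import numFieldNormedType.Exports.
Local Open Scope classical_set_scope.
Local Open Scope ring_scope.

(** The flow is the suspension, under a constant roof of height 1, of the baker map
of the unit square. It preserves a probability measure and has positive entropy,
but the proof only uses that it has many orthogonal families of translates.

Property B fails for every flow that preserves a probability measure, by the
pigeonhole argument behind Poincare recurrence ([mpres_not_property_B]): a set of
positive measure returns to itself at some difference of any sufficiently many
prescribed times, and for large [delta] the times [i * expR s], [i < N], have all
their differences in the required interval.

Ergodicity of the suspension reduces to that of the baker map. A set [A] invariant
under the baker map is independent of the abscissa, because the abscissa evolves
by the doubling map, which is mixing ([dbl_mixing]); since digits of the ordinate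
are earlier digits of the abscissa, it is then independent of all rectangles
([baker_ergodic]).

Approximate transitivity fails by a second-moment argument. The Walsh functions
[walsh j] take the values 1 and -1, have mean 0, and all their translates by the
baker map are orthonormal. Suppose that the [n] functions [1 + walsh j] are close
to the sums over [k] of [lam j k] times the translate of one function [f >= 0] by
the time [t k], and normalize [f] to have integral 1, so that the weights
[lam j k] have sum about 1 for each [j]. Each sum is at most about 2, hence
[f <= 2 / m] where [m] is the largest weight, and the square of [f] has integral
at most [2 / m]. Pairing the [j]-th sum with [walsh j] and adding over [j] shows
that [n] is about the scalar product of [f] with the sum over [j] and [k] of
[lam j k] times a translate of [walsh j]. By orthogonality the square of the norm
of the latter is at most [m * n], so [n] is at most about the square root of
[2 * n], which is false for large [n]. [correlation_bound] makes this
quantitative when [f] is only mostly below [2 / m], and [no_common_approximation]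
deals with real times, for which close translates are correlated. *)

(** * Means of bounded measurable functions *)

(** On a probability space these functions form an algebra on which the integral is
finite and linear, and iterated integrals can be exchanged, so that the estimates
below are made with real numbers. *)

Section bounded_measurable.
Context d (T : measurableType d) (R : realType).
Implicit Types f g : T -> R.

Definition bmeas f := measurable_fun setT f /\ exists M : R, forall x, `|f x| <= M.

Lemma bmeas_ge0 f : bmeas f -> exists2 M, 0 <= M & forall x, `|f x| <= M.
Proof.
move=> [_ [M fM]]; exists `|M| => // x.
exact: le_trans (fM x) (ler_norm _).
Qed.

Lemma bmeas_cst (c : R) : bmeas (fun=> c).
Proof. by split => //; exists `|c|. Qed.

Lemma bmeasD f g : bmeas f -> bmeas g -> bmeas (fun x => f x + g x).
Proof.
move=> [mf [M fM]] [mg [N gN]]; split; first exact: measurable_funD.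
by exists (M + N) => x; rewrite (le_trans (ler_normD _ _))// lerD.
Qed.

Lemma bmeasN f : bmeas f -> bmeas (fun x => - f x).
Proof.
move=> [mf [M fM]]; split; first exact: measurableT_comp.
by exists M => x; rewrite normrN.
Qed.

Lemma bmeasB f g : bmeas f -> bmeas g -> bmeas (fun x => f x - g x).
Proof. by move=> bf bg; apply: bmeasD => //; exact: bmeasN. Qed.

Lemma bmeasM f g : bmeas f -> bmeas g -> bmeas (fun x => f x * g x).
Proof.
move=> [mf [M fM]] [mg [N gN]]; split; first exact: measurable_funM.
by exists (M * N) => x; rewrite normrM ler_pM.
Qed.

Lemma bmeasZ (c : R) f : bmeas f -> bmeas (fun x => c * f x).
Proof. by move=> bf; apply: bmeasM => //; exact: bmeas_cst. Qed.

Lemma bmeas_norm f : bmeas f -> bmeas (fun x => `|f x|).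
Proof.
move=> [mf [M fM]]; split; first exact: measurableT_comp.
by exists M => x; rewrite normr_id.
Qed.

Lemma bmeas_max f g : bmeas f -> bmeas g -> bmeas (fun x => Num.max (f x) (g x)).
Proof.
move=> [mf [M fM]] [mg [N gN]]; split; first exact: measurable_maxr.
exists (Num.max M N) => x; rewrite le_max.
by case: (leP (f x) (g x)) => _; rewrite ?fM ?gN ?orbT.
Qed.

Lemma bmeas_min f g : bmeas f -> bmeas g -> bmeas (fun x => Num.min (f x) (g x)).
Proof.
move=> [mf [M fM]] [mg [N gN]]; split; first exact: measurable_minr.
exists (Num.max M N) => x; rewrite le_max.
by case: (leP (f x) (g x)) => _; rewrite ?fM ?gN ?orbT.
Qed.

Lemma bmeas_sum (I : Type) (r : seq I) (Q : pred I) (f : I -> T -> R) :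
  (forall i, bmeas (f i)) -> bmeas (fun x => \sum_(i <- r | Q i) f i x).
Proof.
move=> bf; elim: r => [|i r IH].
  under eq_fun do rewrite big_nil; exact: bmeas_cst.
under eq_fun do rewrite big_cons; case: (Q i) => //; exact: bmeasD.
Qed.

Lemma bmeas_indic (A : set T) : measurable A -> bmeas (\1_A : T -> R).
Proof.
move=> mA; split; first exact: measurable_indic.
by exists 1 => x; rewrite indicE; case: (_ \in _); rewrite ?normr1 ?normr0.
Qed.

End bounded_measurable.

Lemma bmeas_comp d d' (T : measurableType d) (T' : measurableType d')
    (R : realType) (f : T' -> R) (u : T -> T') :
  bmeas f -> measurable_fun setT u -> bmeas (fun x => f (u x)).
Proof.
move=> [mf [M fM]] mu; split; first exact: measurableT_comp.
by exists M.
Qed.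

Section mean.
Context d (T : measurableType d) (R : realType) (P : probability T R).
Implicit Types f g : T -> R.

Definition mean f : R := (\int[P]_x f x)%R.

Lemma bmeas_integrable f : bmeas f -> P.-integrable setT (EFin \o f).
Proof.
move=> [mf [M fM]].
apply: (@le_integrable _ _ _ P _ measurableT _ (EFin \o cst M)).
- exact/measurable_EFinP.
- by move=> x _ /=; rewrite lee_fin (le_trans (fM x))// ler_norm.
- exact: finite_measure_integrable_cst.
Qed.

Lemma EFin_mean f : bmeas f -> (mean f)%:E = (\int[P]_x (f x)%:E)%E.
Proof.
move=> bf; rewrite /mean /Rintegral fineK//.
by apply: integrable_fin_num => //; exact: bmeas_integrable.
Qed.

Lemma eq_mean f g : f =1 g -> mean f = mean g.
Proof. by move=> fg; apply: eq_Rintegral => x _. Qed.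

Lemma meanD f g : bmeas f -> bmeas g ->
  mean (fun x => f x + g x) = mean f + mean g.
Proof. by move=> bf bg; rewrite /mean RintegralD//; exact: bmeas_integrable. Qed.

Lemma meanB f g : bmeas f -> bmeas g ->
  mean (fun x => f x - g x) = mean f - mean g.
Proof. by move=> bf bg; rewrite /mean RintegralB//; exact: bmeas_integrable. Qed.

Lemma meanZ (c : R) f : bmeas f -> mean (fun x => c * f x) = c * mean f.
Proof. by move=> bf; rewrite /mean RintegralZl//; exact: bmeas_integrable. Qed.

Lemma mean_cst (c : R) : mean (fun=> c) = c.
Proof.
rewrite /mean Rintegral_cst//.
by have /= -> := probability_setT P; rewrite mulr1.
Qed.

Lemma mean_sum (I : Type) (r : seq I) (Q : pred I) (f : I -> T -> R) :
  (forall i, bmeas (f i)) ->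
  mean (fun x => \sum_(i <- r | Q i) f i x) = \sum_(i <- r | Q i) mean (f i).
Proof.
move=> bf; elim: r => [|i r IH].
  by rewrite big_nil -[RHS]mean_cst; apply: eq_mean => x; rewrite big_nil.
rewrite big_cons -IH; case: ifPn => Qi; last first.
  by apply: eq_mean => x; rewrite big_cons (negbTE Qi).
rewrite -meanD//; last exact: bmeas_sum.
by apply: eq_mean => x; rewrite big_cons Qi.
Qed.

Lemma le_mean f g : bmeas f -> bmeas g -> (forall x, f x <= g x) ->
  mean f <= mean g.
Proof.
by move=> bf bg fg; apply: le_Rintegral => //; exact: bmeas_integrable.
Qed.

Lemma mean_ge0 f : (forall x, 0 <= f x) -> 0 <= mean f.
Proof. by move=> f0; apply: Rintegral_ge0. Qed.

Lemma le_norm_mean f : bmeas f -> `|mean f| <= mean (fun x => `|f x|).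
Proof. by move=> bf; apply: le_normr_Rintegral => //; exact: bmeas_integrable. Qed.

Lemma mean_indic (A : set T) : measurable A -> (mean \1_A)%:E = P A.
Proof.
move=> mA; rewrite EFin_mean; last exact: bmeas_indic.
by rewrite integral_indic// setIT.
Qed.

End mean.

Section mean_comp.
Context d d' (T : measurableType d) (T' : measurableType d') (R : realType).
Context (P : probability T R) (P' : probability T' R).

(** Invariance is asked for functions rather than for sets: it is checked below
by changes of variables, and only ever used on integrals. *)
Definition mpres (u : T -> T') := measurable_fun setT u /\
  forall g, bmeas g -> mean P (fun x => g (u x)) = mean P' g.

Lemma mpres_set u A : mpres u -> measurable A -> P (u @^-1` A) = P' A.
Proof.
move=> [mu uE] mA.
have muA : measurable (u @^-1` A) by rewrite -[X in measurable X]setTI; exact: mu.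
rewrite -!mean_indic// -uE; last exact: bmeas_indic.
by congr EFin; apply: eq_mean => x; rewrite !indicE/=.
Qed.

End mean_comp.

Section mean_fubini.
Context d d' (T : measurableType d) (T' : measurableType d') (R : realType).
Context (P : probability T R) (P' : probability T' R).
Implicit Types f : T * T' -> R.

Lemma bmeas_pair1 f x : bmeas f -> bmeas (fun y => f (x, y)).
Proof. by move=> bf; apply: bmeas_comp bf _; exact: measurable_fun_pair. Qed.

Lemma bmeas_pair2 f y : bmeas f -> bmeas (fun x => f (x, y)).
Proof. by move=> bf; apply: bmeas_comp bf _; exact: measurable_fun_pair. Qed.

Lemma bmeas_mean1 f : bmeas f -> bmeas (fun x => mean P' (fun y => f (x, y))).
Proof.
move=> bf; split.
  apply/measurable_EFinP.
  rewrite (_ : _ \o _ = fubini_F P' (EFin \o f)).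
    by apply: (@measurable_fubini_F _ _ _ _ _ P P'); exact: bmeas_integrable.
  by apply/funext => x /=; rewrite EFin_mean//; exact: bmeas_pair1.
have [_ [M fM]] := bf; exists M => x.
have bx := bmeas_pair1 x bf.
rewrite (le_trans (le_norm_mean _ bx))// -[leRHS](mean_cst P').
by apply: le_mean => //; [exact: bmeas_norm|exact: bmeas_cst].
Qed.

Lemma bmeas_mean2 f : bmeas f -> bmeas (fun y => mean P (fun x => f (x, y))).
Proof.
move=> bf; split.
  apply/measurable_EFinP.
  rewrite (_ : _ \o _ = fubini_G P (EFin \o f)).
    by apply: (@measurable_fubini_G _ _ _ _ _ P P'); exact: bmeas_integrable.
  by apply/funext => x /=; rewrite EFin_mean//; exact: bmeas_pair2.
have [_ [M fM]] := bf; exists M => x.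
have bx := bmeas_pair2 x bf.
rewrite (le_trans (le_norm_mean _ bx))// -[leRHS](mean_cst P).
by apply: le_mean => //; [exact: bmeas_norm|exact: bmeas_cst].
Qed.

Lemma mean_prod f : bmeas f ->
  mean (P \x P')%E f = mean P (fun x => mean P' (fun y => f (x, y))).
Proof.
move=> bf; apply: EFin_inj; rewrite EFin_mean// EFin_mean; last exact: bmeas_mean1.
rewrite -integral12_prod_meas1; last exact: bmeas_integrable.
apply: eq_integral => x _ /=; rewrite EFin_mean//; exact: bmeas_pair1.
Qed.

Lemma mean_prodC f : bmeas f ->
  mean (P \x P')%E f = mean P' (fun y => mean P (fun x => f (x, y))).
Proof.
move=> bf; apply: EFin_inj; rewrite EFin_mean// EFin_mean; last exact: bmeas_mean2.
rewrite -integral21_prod_meas1; last exact: bmeas_integrable.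
apply: eq_integral => x _ /=; rewrite EFin_mean//; exact: bmeas_pair2.
Qed.

Lemma mean_exchange f : bmeas f ->
  mean P (fun x => mean P' (fun y => f (x, y))) =
  mean P' (fun y => mean P (fun x => f (x, y))).
Proof. by move=> bf; rewrite -mean_prod// mean_prodC. Qed.

End mean_fubini.

(** * Correlations with an orthonormal family *)

(** [lam a] is the largest value of [lam] above which, itself included, weight at
least [eta] is still found. *)
Lemma weight_threshold (R : realType) (I : finType) (Q : pred I)
    (w lam : I -> R) (eta : R) : (forall i, 0 <= w i) -> 0 < eta ->
    eta <= \sum_(i | Q i) w i ->
  exists a, [/\ Q a, eta <= \sum_(i | Q i && (lam a <= lam i)) w i &
    \sum_(i | Q i && (lam a < lam i)) w i < eta].
Proof.
move=> w0 eta0 etaQ.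
have atmin (Q' : pred I) : eta <= \sum_(i | Q' i) w i -> exists a,
    Q' a /\ eta <= \sum_(i | Q' i && (lam a <= lam i)) w i.
  move=> etaQ'.
  have [i0 Qi0] : exists i, Q' i.
    case: (pickP Q') => [i Qi|nQ]; first by exists i.
    by move: etaQ'; rewrite big_pred0// leNgt eta0.
  have [a Qa amin] := arg_minP lam Qi0.
  exists a; split=> //; rewrite (le_trans etaQ')// le_eqVlt; apply/orP; left.
  apply/eqP; apply: eq_bigl => i; case: (boolP (Q' i)) => //= Qi.
  by rewrite amin.
pose K a := Q a && (eta <= \sum_(i | Q i && (lam a <= lam i)) w i).
have [a0 [Qa0 ea0]] := atmin _ etaQ.
have Ka0 : K a0 by rewrite /K Qa0.
have [a /andP[Qa ea] amax] := arg_maxP lam Ka0.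
exists a; split => //; rewrite ltNge; apply/negP => /atmin[b [/andP[Qb ab] eb]].
suff /amax : K b by rewrite /Order.ge/= leNgt ab.
rewrite /K Qb/= (le_trans eb)//.
rewrite [leRHS](bigID (fun i => lam a < lam i))/=.
rewrite [X in _ <= X + _](_ : _ =
  \sum_(i | Q i && (lam a < lam i) && (lam b <= lam i)) w i).
  by rewrite lerDl sumr_ge0.
by apply: eq_bigl => i; rewrite -!andbA; congr andb; rewrite andbC.
Qed.

Section correlation_bound.
Context d (T : measurableType d) (R : realType) (P : probability T R).
Context (I : finType) (Q : pred I) (lam : I -> R) (h : T -> R)
  (psi : I -> T -> R).
Hypothesis lam0 : forall i, 0 <= lam i.
Hypothesis bh : bmeas h.
Hypothesis h0 : forall x, 0 <= h x.
Hypothesis hI : 0 < mean P h.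
Hypothesis bpsi : forall i, bmeas (psi i).
Hypothesis psi1 : forall i x, `|psi i x| <= 1.
Hypothesis orth : forall i j, Q i -> Q j -> i != j ->
  mean P (fun x => psi i x * psi j x) = 0.

(** Bessel's inequality for weights at most [m]: the squares of the weights sum
to at most [m] times their sum. *)
Lemma mean_sqr_orth (S : pred I) (m : R) : {subset S <= Q} ->
    (forall i, S i -> lam i <= m) ->
  mean P (fun x => (\sum_(i | S i) lam i * psi i x) ^+ 2) <=
  m * \sum_(i | S i) lam i.
Proof.
move=> SQ Sm.
have bpp i j : bmeas (fun x => psi i x * psi j x) by exact: bmeasM.
have -> : mean P (fun x => (\sum_(i | S i) lam i * psi i x) ^+ 2) =
    \sum_(i | S i) \sum_(j | S j)
      lam i * lam j * mean P (fun x => psi i x * psi j x).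
  transitivity (mean P (fun x => \sum_(i | S i) \sum_(j | S j)
      lam i * lam j * (psi i x * psi j x))).
    apply: eq_mean => x; rewrite expr2 mulr_suml; apply: eq_bigr => i Si.
    by rewrite mulr_sumr; apply: eq_bigr => j Sj; ring.
  rewrite mean_sum => [|i]; last by apply: bmeas_sum => j; exact: bmeasZ.
  apply: eq_bigr => i _; rewrite mean_sum => [|j]; last exact: bmeasZ.
  by apply: eq_bigr => j _; rewrite meanZ.
rewrite mulr_sumr; apply: ler_sum => i Si.
rewrite (bigD1 i)//= big1 ?addr0 => [|j /andP[Sj ji]]; last first.
  by rewrite orth ?mulr0//; [exact: SQ|exact: SQ|rewrite eq_sym].
have : mean P (fun x => psi i x * psi i x) <= 1.
  rewrite -[leRHS](mean_cst P); apply: le_mean => //; first exact: bmeas_cst.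
  move=> x; rewrite (le_trans (ler_norm _))// normrM mulr_ile1//.
move=> p1; rewrite -[leRHS]mulr1; apply: ler_pM => //.
- by rewrite mulr_ge0.
- by apply: mean_ge0 => x; rewrite -expr2 sqr_ge0.
- by rewrite ler_wpM2r// Sm.
Qed.

(** Exactly bounded case: if [lam i * h <= 2] for all [i], and [m] is the largest
weight, then [h <= 2 / m], so the square of [h] has mean at most [2 / m] times
the mean of [h]. By Cauchy-Schwarz and [mean_sqr_orth] the left-hand side is
then at most [sigma + W / (2 * sigma)] for every [sigma].
In general [m] is the threshold weight of [weight_threshold]. The weights above
[m] cost at most [eta]. Those that are at least [m] carry mass at least [eta],
so the excess bound [delta] controls the mean of the part of [h] above [2 / m],
which costs at most [W * delta / eta] in all. *)
Lemma correlation_bound (W delta eta sigma : R) : 0 < eta -> 0 < sigma ->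
    0 <= delta ->
    \sum_(i | Q i) lam i * mean P h <= W ->
    \sum_(i | Q i) mean P (fun x => Num.max (lam i * h x - 2) 0) <= delta ->
  \sum_(i | Q i) lam i * mean P (fun x => h x * psi i x) <=
    eta + W * delta / eta + sigma + W / (2 * sigma).
Proof.
move=> eta0 sig0 del0 hW hd.
set J := mean P h in hW *.
have J0 : 0 < J by exact: hI.
have w0 i : 0 <= lam i * J by rewrite mulr_ge0// ltW.
have W0 : 0 <= W by apply: le_trans hW; apply: sumr_ge0.
have bhp i : bmeas (fun x => h x * psi i x) by exact: bmeasM.
have hp (g : T -> R) i : bmeas g -> (forall x, 0 <= g x) ->
    mean P (fun x => g x * psi i x) <= mean P g.
  move=> bg g0; apply: le_mean => // [|x]; first exact: bmeasM.
  rewrite -[leRHS]mulr1 ler_wpM2l//.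
  by rewrite (le_trans (ler_norm _)).
have [small|big] := ltP (\sum_(i | Q i) lam i * J) eta.
  apply: (@le_trans _ _ eta).
    apply: le_trans (ltW small); apply: ler_sum => i Qi.
    by rewrite ler_wpM2l// hp.
  rewrite -!addrA lerDl addr_ge0// ?addr_ge0 ?divr_ge0 ?mulr_ge0// ltW//.
have [a [Qa ea ae]] := weight_threshold lam w0 eta0 big.
set m := lam a in ea ae.
have m0 : 0 < m.
  rewrite lt_neqAle lam0 andbT; apply/negP => /eqP m0; move: ae; rewrite ltNge.
  move=> /negP; apply; apply: (le_trans ea).
  rewrite -m0 (bigID (fun i => 0 < lam i))/= [X in _ + X]big1 => [|i].
    rewrite addr0 le_eqVlt; apply/orP; left; apply/eqP; apply: eq_bigl => i.
    by rewrite lam0 andbT.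
  by rewrite lt_neqAle lam0 !andbT => /andP[_]; rewrite negbK => /eqP <-; rewrite mul0r.
(* [h] splits into its truncation [hc] at [c] and the excess [k]. *)
pose c := 2 / m.
have c0 : 0 < c by rewrite divr_gt0.
pose hc x := Num.min (h x) c.
pose k x := Num.max (h x - c) 0.
have bhc : bmeas hc by apply: bmeas_min => //; exact: bmeas_cst.
have bk : bmeas k.
  by apply: bmeas_max; [apply: bmeasB => //|]; exact: bmeas_cst.
have hE x : h x = hc x + k x.
  by rewrite /hc /k; case: (leP (h x) c) => ?; case: leP; lra.
have hc0 x : 0 <= hc x by rewrite /hc le_min h0 ltW.
have k0 x : 0 <= k x by rewrite /k le_max lexx orbT.
have Ek : mean P k * eta <= delta * J.
  apply: (@le_trans _ _ (mean P k * \sum_(i | Q i && (m <= lam i)) lam i * J)).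
    by rewrite ler_wpM2l// mean_ge0.
  rewrite -mulr_suml mulrA ler_wpM2r ?(ltW J0)//.
  apply: le_trans hd.
  rewrite mulr_sumr [leRHS](bigID (fun i => m <= lam i))/=.
  rewrite -[leLHS]addr0 lerD//; last first.
    by apply: sumr_ge0 => i _; apply: mean_ge0 => x; rewrite le_max lexx orbT.
  apply: ler_sum => i /andP[Qi mi]; rewrite mulrC -meanZ//; apply: le_mean.
  - exact: bmeasZ.
  - by apply: bmeas_max; [apply: bmeasB; [exact: bmeasZ|]|]; exact: bmeas_cst.
  - move=> x; rewrite /k; case: (leP (h x - c) 0) => hxc.
      by rewrite mulr0 le_max lexx orbT.
    rewrite le_max; apply/orP; left; rewrite mulrBr lerB//.
    by rewrite /c mulrA ler_pdivlMr// mulrC ler_wpM2r.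
pose S := [pred i | Q i && (lam i <= m)].
have -> : \sum_(i | Q i) lam i * mean P (fun x => h x * psi i x) =
   \sum_(i | Q i && (m < lam i)) lam i * mean P (fun x => h x * psi i x) +
   (\sum_(i | S i) lam i * mean P (fun x => k x * psi i x) +
    mean P (fun x => hc x * (\sum_(i | S i) lam i * psi i x))).
  rewrite (bigID (fun i => m < lam i))/=; congr (_ + _).
  have -> : mean P (fun x => hc x * (\sum_(i | S i) lam i * psi i x)) =
      \sum_(i | S i) lam i * mean P (fun x => hc x * psi i x).
    transitivity (mean P (fun x => \sum_(i | S i) lam i * (hc x * psi i x))).
      by apply: eq_mean => x; rewrite mulr_sumr; apply: eq_bigr => i _; ring.
    rewrite mean_sum => [|i]; last by apply: bmeasZ; exact: bmeasM.
    by apply: eq_bigr => i _; rewrite meanZ//; exact: bmeasM.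
  rewrite -big_split/=; apply: eq_big => [i|i _]; first by rewrite -leNgt.
  rewrite -mulrDr -meanD; [|exact: bmeasM..]; congr (_ * _).
  by apply: eq_mean => x; rewrite hE; ring.
have part1 : \sum_(i | Q i && (m < lam i)) lam i * mean P (fun x => h x * psi i x)
    <= eta.
  apply: le_trans (ltW ae); apply: ler_sum => i _.
  by rewrite ler_wpM2l// hp.
have lamS : (\sum_(i | S i) lam i) * J <= W.
  apply: le_trans hW; rewrite mulr_suml [leRHS](bigID (fun i => lam i <= m))/=.
  by rewrite lerDl sumr_ge0.
have part2 : \sum_(i | S i) lam i * mean P (fun x => k x * psi i x)
    <= W * delta / eta.
  apply: (@le_trans _ _ ((\sum_(i | S i) lam i) * mean P k)).
    by rewrite mulr_suml; apply: ler_sum => i _; rewrite ler_wpM2l// hp.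
  rewrite ler_pdivlMr// -mulrA.
  apply: (@le_trans _ _ ((\sum_(i | S i) lam i) * (delta * J))).
    by rewrite ler_wpM2l// sumr_ge0.
  by rewrite mulrCA [leRHS]mulrC ler_wpM2l.
suff part3 : mean P (fun x => hc x * (\sum_(i | S i) lam i * psi i x))
    <= sigma + W / (2 * sigma).
  by move: part1 part2 part3; lra.
(* The arithmetic-geometric inequality with weight [s] replaces Cauchy-Schwarz. *)
pose s := sigma * m / J.
have s0 : 0 < s by rewrite divr_gt0// mulr_gt0.
pose Psi x := \sum_(i | S i) lam i * psi i x.
have bPsi : bmeas Psi by apply: bmeas_sum => i; exact: bmeasZ.
apply: (@le_trans _ _ (mean P (fun x => s / 2 * c * h x + (2 * s)^-1 * (Psi x) ^+ 2))).
  apply: le_mean.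
  - exact: bmeasM.
  - by apply: bmeasD; [exact: bmeasZ|apply: bmeasZ; exact: bmeasM].
  - move=> x; rewrite -/(Psi x).
    have : hc x ^+ 2 <= c * h x.
      rewrite expr2; apply: ler_pM => //; rewrite /hc ge_min lexx ?orbT//.
    move=> hcc; apply: (@le_trans _ _ (s / 2 * (hc x) ^+ 2 + (2 * s)^-1 * Psi x ^+ 2)).
      rewrite -subr_ge0.
      suff -> : s / 2 * hc x ^+ 2 + (2 * s)^-1 * Psi x ^+ 2 - hc x * Psi x =
          (2 * s)^-1 * (s * hc x - Psi x) ^+ 2.
        by rewrite mulr_ge0 ?sqr_ge0// invr_ge0 mulr_ge0 ?ltW.
      by field; rewrite gt_eqF.
    by rewrite lerD2r -[leRHS]mulrA ler_wpM2l// divr_ge0// ltW.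
rewrite meanD; [|exact: bmeasZ|by apply: bmeasZ; exact: bmeasM].
rewrite !meanZ//; last exact: bmeasM.
rewrite -/J lerD//.
  rewrite /s /c le_eqVlt; apply/orP; left; apply/eqP; field.
  by rewrite !gt_eqF.
apply: (@le_trans _ _ ((2 * s)^-1 * (m * \sum_(i | S i) lam i))).
  have i0 : 0 <= (2 * s)^-1 by rewrite invr_ge0 ltW// mulr_gt0.
  by rewrite ler_wpM2l//; apply: (@mean_sqr_orth S m) => i /andP[].
have -> : (2 * s)^-1 * (m * \sum_(i | S i) lam i) =
    ((\sum_(i | S i) lam i) * J) / (2 * sigma).
  by rewrite /s; field; rewrite !gt_eqF.
by rewrite ler_wpM2r// invr_ge0 mulr_ge0// ltW.
Qed.

End correlation_bound.

(** * The uniform measure on the unit interval *)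

Section unit_interval.
Context (R : realType).
Local Notation RR := (measurableTypeR R).
Local Notation leb := (@lebesgue_measure R).
Implicit Types f g : RR -> R.

Lemma measurable_affine (c d : R) : measurable_fun setT ((fun x => c * x + d) : RR -> RR).
Proof. by apply: measurable_funD => //; exact: measurable_funM. Qed.

Lemma lebesgue_affine (c d : R) (A : set RR) : 0 < c -> measurable A ->
  leb A = (c%:E * leb ((fun x : RR => (c * x + d)%R : RR) @^-1` A))%E.
Proof.
move=> c0 mA.
pose phi : RR -> RR := fun x => c * x + d.
have mphi : measurable_fun setT phi by exact: measurable_affine.
pose k : {nonneg R} := NngNum (ltW c0).
(* A pushforward is a measure given a proof of measurability, here [mphi]. *)
pose m' : {measure set RR -> \bar R} := mscale k (pushforward leb phi).
pose m := m' mphi.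
transitivity (m A); last by [].
apply: lebesgue_measure_unique => // X [[a b] _ <-].
rewrite /m /m'/= /mscale/= /pushforward/=.
rewrite (_ : phi @^-1` _ = `](a - d) / c, (b - d) / c]%classic); last first.
  apply/seteqP; split => x /=; rewrite !in_itv/= /phi ltr_pdivrMr// ler_pdivlMr//;
  by rewrite ltrBlDr lerBrDr (mulrC x).
rewrite !lebesgue_measure_itv/= !lte_fin ltr_pM2r ?invr_gt0// ltrD2r.
case: ifP => ab; last by rewrite mule0.
by rewrite -!EFinB -EFinM; congr EFin; field; rewrite gt_eqF.
Qed.

Lemma ge0_integral_affine (c d : R) (h : RR -> \bar R) : 0 < c ->
    measurable_fun setT h -> (forall x, 0 <= h x)%E ->
  (\int[leb]_x h x = c%:E * \int[leb]_x h ((c * x + d)%R : RR))%E.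
Proof.
move=> c0 mh h0.
pose phi : RR -> RR := fun x => c * x + d.
have mphi : measurable_fun setT phi by exact: measurable_affine.
pose k : {nonneg R} := NngNum (ltW c0).
pose m' : {measure set RR -> \bar R} := mscale k (pushforward leb phi).
pose m := m' mphi.
transitivity (\int[m]_x h x)%E.
  by apply: eq_measure_integral => A mA _; exact: (@lebesgue_affine c d).
rewrite /m /m' ge0_integral_mscale//=; congr (_ * _)%E.
by rewrite ge0_integral_pushforward.
Qed.

Definition iint (a b : R) f : R := \int[leb]_(x in `[a, b[) f x.

Lemma bmeas_integrable_itv (a b : R) f : bmeas f ->
  leb.-integrable `[a, b[ (EFin \o f).
Proof.
move=> [mf [M fM]].
apply: (@le_integrable _ _ _ leb _ _ _ (EFin \o cst M)) => //.
- by apply/measurable_EFinP; exact: measurable_funTS.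
- by move=> x _ /=; rewrite lee_fin (le_trans (fM x))// ler_norm.
apply/integrableP; split; first exact/measurable_EFinP.
rewrite (eq_integral (fun=> `|M|%:E)) => [|x _]; last by [].
rewrite integral_cst//= lebesgue_measure_itv/= lte_fin.
by case: ifP => _; rewrite ?mule0// -EFinB -EFinM ltry.
Qed.

Lemma iintD (a b : R) f g : bmeas f -> bmeas g ->
  iint a b (fun x => f x + g x) = iint a b f + iint a b g.
Proof. by move=> bf bg; rewrite /iint RintegralD//; exact: bmeas_integrable_itv. Qed.

Lemma le_iint (a b : R) f g : bmeas f -> bmeas g ->
  (forall x, a <= x < b -> f x <= g x) -> iint a b f <= iint a b g.
Proof.
by move=> bf bg fg; apply: le_Rintegral => //; exact: bmeas_integrable_itv.
Qed.

Lemma eq_iint (a b : R) f g :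
  (forall x, a <= x < b -> f x = g x) -> iint a b f = iint a b g.
Proof.
by move=> fg; apply: eq_Rintegral => x; rewrite inE/= in_itv/=; exact: fg.
Qed.

Lemma iint_cst (a b c : R) : a <= b -> iint a b (fun=> c) = c * (b - a).
Proof.
move=> ab; rewrite /iint Rintegral_cst//= lebesgue_measure_itv/= lte_fin.
case: ifPn; first by rewrite -EFinB.
by rewrite -leNgt => ba; rewrite (@le_anti _ _ a b) ?ab// subrr.
Qed.

Lemma iint_split (a b c : R) f : bmeas f -> a <= b -> b <= c ->
  iint a c f = iint a b f + iint b c f.
Proof.
move=> bf ab bc; rewrite /iint.
rewrite (@itv_bndbnd_setU _ _ _ (BLeft b)) ?bnd_simp//.
rewrite Rintegral_setU//.
- rewrite -itv_bndbnd_setU ?bnd_simp//; exact: bmeas_integrable_itv.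
- apply/disj_setPS => x [] /=; rewrite !in_itv/= => /andP[_ xb] /andP[bx _].
  by move: xb; rewrite ltNge bx.
Qed.

(** Stated for nonnegative [f] because the change of variables holds for the
integral of nonnegative functions; a constant is added for the other ones. *)
Lemma iint_affine_ge0 (a b c d : R) f : 0 < c -> bmeas f -> (forall x, 0 <= f x) ->
  c * iint a b (fun x => f (c * x + d)) = iint (c * a + d) (c * b + d) f.
Proof.
move=> c0 bf f0.
have bfa : bmeas (fun x : RR => f (c * x + d)).
  by apply: (bmeas_comp (u := fun x : RR => (c * x + d : RR)) bf); exact: measurable_affine.
apply: EFin_inj; rewrite EFinM /iint /Rintegral !fineK; last 2 first.
- by apply: integrable_fin_num => //; exact: bmeas_integrable_itv.
- by apply: integrable_fin_num => //; exact: bmeas_integrable_itv.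
rewrite integral_mkcond [RHS]integral_mkcond.
rewrite [RHS](@ge0_integral_affine c d)//.
- congr (_ * _)%E; apply: eq_integral => x _.
  rewrite /patch /=; congr (if _ then _ else _).
  apply/idP/idP; rewrite !inE/= !in_itv/= lerD2r ltrD2r ler_pM2l// ltr_pM2l//.
- apply/(measurable_restrictT _ _).1 => //; apply/measurable_EFinP.
  by apply: measurable_funTS; case: bf.
- by move=> x; rewrite /patch; case: ifP => // _; rewrite lee_fin.
Qed.

Lemma iint_affine (a b c d : R) f : a <= b -> 0 < c -> bmeas f ->
  c * iint a b (fun x => f (c * x + d)) = iint (c * a + d) (c * b + d) f.
Proof.
move=> ab c0 bf; have [M M0 fM] := bmeas_ge0 bf.
have bM : bmeas (fun x : RR => f x + M) by apply: bmeasD => //; exact: bmeas_cst.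
have bfa : bmeas (fun x : RR => f (c * x + d)).
  by apply: (bmeas_comp (u := fun x : RR => (c * x + d : RR)) bf); exact: measurable_affine.
have fM0 x : 0 <= f x + M by have := fM x; rewrite ler_norml; lra.
have := iint_affine_ge0 a b d c0 bM fM0.
rewrite !iintD//; try exact: bmeas_cst.
rewrite !iint_cst//; last by rewrite lerD2r ler_pM2l.
lra.
Qed.

Definition unif : probability RR R := uniform_prob (@ltr01 R).

Lemma mean_unif f : bmeas f -> mean unif f = iint 0 1 f.
Proof.
move=> bf; have [M M0 fM] := bmeas_ge0 bf.
have bM : bmeas (fun x : RR => f x + M) by apply: bmeasD => //; exact: bmeas_cst.
have fM0 x : 0 <= f x + M by have := fM x; rewrite ler_norml; lra.
suff : mean unif (fun x => f x + M) = iint 0 1 (fun x => f x + M).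
  rewrite iintD//; last exact: bmeas_cst.
  rewrite meanD//; last exact: bmeas_cst.
  by rewrite mean_cst iint_cst//; lra.
rewrite /mean /Rintegral integral_uniform//.
- rewrite subr0 invr1 mul1e -/(Rintegral leb `[0, 1]%classic _).
  by rewrite -Rintegral_itv_bndo_bndc//; exact: bmeas_integrable_itv.
- by apply/measurable_EFinP; case: bM.
Qed.

End unit_interval.

(** ** Functions defined through an integer part *)

Section integer_gluing.
Context d d' (T : measurableType d) (T' : measurableType d').

Lemma measurable_fun_int (k : T -> int) (u : int -> T -> T') :
    (forall i, measurable (k @^-1` [set i])) ->
    (forall i, measurable_fun setT (u i)) ->
  measurable_fun setT (fun x => u (k x) x).
Proof.
move=> mk mu _ B mB; rewrite setTI.
rewrite (_ : _ @^-1` B = \bigcup_i (k @^-1` [set i] `&` u i @^-1` B)).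
  apply: countable_bigcupT_measurable => [|i]; first exact: countableP.
  apply: measurableI => //.
  by rewrite -[X in measurable X]setTI; exact: mu.
apply/seteqP; split => [x Bx|x [i _ [/= <-]]//]; by exists (k x).
Qed.

End integer_gluing.

Lemma measurable_floor_preimage d (T : measurableType d) (R : realType)
    (f : T -> R) (i : int) : measurable_fun setT f ->
  measurable ((fun x => Num.floor (f x)) @^-1` [set i]).
Proof.
move=> mf.
rewrite (_ : _ @^-1` _ = f @^-1` `[i%:~R, (i + 1)%:~R[).
  by rewrite -[X in measurable X]setTI; apply: mf.
apply/seteqP; split => x /=; rewrite in_itv/=.
  by move=> <-; exact: floor_itv.
exact: floor_def.
Qed.

(** ** Changes of variables in the unit interval *)

Section unit_interval_identities.
Context (R : realType).
Local Notation RR := (measurableTypeR R).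
Implicit Types f g : RR -> R.

Definition fpart (x : R) : R := x - (Num.floor x)%:~R.

Lemma fpart_itv x : 0 <= fpart x < 1.
Proof.
have := floor_itv x; rewrite /fpart intrD; lra.
Qed.

Lemma measurable_fpart : measurable_fun setT (fpart : RR -> RR).
Proof.
apply: (@measurable_fun_int _ _ RR RR (fun x => Num.floor x)
  (fun i x => x - i%:~R)) => i.
  by apply: measurable_floor_preimage; exact: measurable_id.
by apply: measurable_funB.
Qed.

Lemma eq_mean_unif f g : bmeas f -> bmeas g ->
  (forall x, 0 <= x < 1 -> f x = g x) -> mean (unif R) f = mean (unif R) g.
Proof. by move=> bf bg fg; rewrite !mean_unif//; exact: eq_iint. Qed.

Lemma le_mean_unif f g : bmeas f -> bmeas g ->
  (forall x, 0 <= x < 1 -> f x <= g x) -> mean (unif R) f <= mean (unif R) g.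
Proof. by move=> bf bg fg; rewrite !mean_unif//; exact: le_iint. Qed.

Lemma bmeas_affine (c d : R) f : bmeas f -> bmeas (fun x : RR => f (c * x + d)).
Proof.
move=> bf.
apply: (bmeas_comp (u := fun x : RR => (c * x + d : RR)) bf).
exact: measurable_affine.
Qed.

(** The self-similarity of Lebesgue measure; the measure of the baker map and the
independence of the binary digits both come from this identity. *)
Lemma mean_unif_halves f : bmeas f ->
  mean (unif R) f = 2^-1 * (mean (unif R) (fun x => f (x / 2)) +
                            mean (unif R) (fun x => f ((x + 1) / 2))).
Proof.
move=> bf.
have E1 : (fun x : RR => f (x / 2)) = (fun x => f (2^-1 * x + 0)).
  by apply/funext => x; congr f; lra.
have E2 : (fun x : RR => f ((x + 1) / 2)) = (fun x => f (2^-1 * x + 2^-1)).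
  by apply/funext => x; congr f; lra.
rewrite E1 E2 !mean_unif//; [|exact: bmeas_affine..].
rewrite mulrDr !iint_affine//.
rewrite (@iint_split _ 0 2^-1 1)//; [|lra..].
have -> : 2^-1 * 1 + 2^-1 = 1 :> R by lra.
by rewrite mulr0 mulr1 !addr0 add0r.
Qed.

Lemma mean_unif_rotation (t : R) f : bmeas f ->
  mean (unif R) (fun y => f (fpart (y + t))) = mean (unif R) f.
Proof.
move=> bf.
have bt : bmeas (fun y : RR => f (fpart (y + t))).
  apply: (bmeas_comp (u := fun x : RR => (fpart (x + t) : RR)) bf).
  apply: measurableT_comp; first exact: measurable_fpart.
  exact: measurable_funD.
have /andP[r0 r1] := fpart_itv t.
set r := fpart t in r0 r1.
have tE : t = r + (Num.floor t)%:~R by rewrite /r /fpart; lra.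
rewrite !mean_unif// (@iint_split _ 0 (1 - r) 1)//; [|lra..].
rewrite (_ : iint 0 (1 - r) _ = iint 0 (1 - r) (fun y => f (1 * y + r))); last first.
  apply: eq_iint => y yr; congr f; rewrite /fpart.
  by rewrite (@floor_def _ _ (Num.floor t)) ?intrD; lra.
rewrite (_ : iint (1 - r) 1 _ = iint (1 - r) 1 (fun y => f (1 * y + (r - 1)))); last first.
  apply: eq_iint => y yr; congr f; rewrite /fpart.
  by rewrite (@floor_def _ _ (Num.floor t + 1)) ?intrD; lra.
rewrite -[X in X + _]mul1r -[X in _ + X]mul1r !iint_affine//; [|lra..].
rewrite addrC [RHS](@iint_split _ 0 r 1)//; [|lra..].
have -> : 1 * (1 - r) + (r - 1) = 0 by lra.
have -> : 1 * 1 + (r - 1) = r by lra.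
have -> : 1 * (1 - r) + r = 1 by lra.
by rewrite mulr0 add0r.
Qed.

(** The window [[a, 1)] moved back by [s <= a] stays inside [[0, 1)]. *)
Lemma mean_unif_window (a s : R) f : bmeas f -> (forall x, 0 <= f x) ->
    0 <= s <= a -> a <= 1 ->
  mean (unif R) (fun y => \1_(`[a, +oo[%classic : set RR) y * f (y - s)) <=
  mean (unif R) f.
Proof.
move=> bf f0 /andP[s0 sa] a1.
have E : (fun y : RR => f (y - s)) = (fun y => f (1 * y + - s)).
  by apply/funext => y; congr f; lra.
have bs : bmeas (fun y : RR => f (y - s)) by rewrite E; exact: bmeas_affine.
have b1 : bmeas (fun y : RR => \1_(`[a, +oo[%classic : set RR) y * f (y - s)).
  by apply: bmeasM => //; exact: bmeas_indic.
have i0 (u v : R) : 0 <= iint u v f by apply: Rintegral_ge0.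
rewrite !mean_unif// (@iint_split _ 0 a 1)//; [|lra..].
rewrite (_ : iint 0 a _ = iint 0 a (fun=> 0)); last first.
  apply: eq_iint => y ya; rewrite indicE memNset ?mul0r//= in_itv/= andbT.
  by apply/negP; rewrite -ltNge; lra.
rewrite iint_cst ?mul0r ?add0r; last lra.
rewrite (_ : iint a 1 _ = iint a 1 (fun y => f (1 * y + - s))); last first.
  apply: eq_iint => y ya; rewrite indicE mem_set ?mul1r//= in_itv/= andbT.
  lra.
rewrite -[leLHS]mul1r iint_affine//.
rewrite [leRHS](@iint_split _ 0 (1 * a + - s) 1)//; [|lra..].
rewrite [X in _ <= _ + X](@iint_split _ (1 * a + - s) (1 * 1 + - s) 1)//; [|lra..].
by rewrite -[leLHS]add0r lerD// -[leLHS]addr0 lerD.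
Qed.

Lemma mean_unif_below (c : R) : 0 <= c <= 1 ->
  mean (unif R) \1_(`]-oo, c[%classic : set RR) = c.
Proof.
move=> c01; rewrite mean_unif; last exact: bmeas_indic.
rewrite (@iint_split _ 0 c 1)//; [|exact: bmeas_indic|lra..].
rewrite (_ : iint 0 c _ = iint 0 c (fun=> 1)); last first.
  by apply: eq_iint => y yc; rewrite indicE mem_set//= in_itv/=; lra.
rewrite (_ : iint c 1 _ = iint c 1 (fun=> 0)); last first.
  apply: eq_iint => y yc; rewrite indicE memNset//= in_itv/=.
  by apply/negP; rewrite -leNgt; lra.
by rewrite !iint_cst; lra.
Qed.

End unit_interval_identities.

(** * Common approximation by translates of one function *)

Lemma sum_excess_le (R : realType) (I : finType) (a : I -> R) (c : R) :
    (forall i, 0 <= a i) -> 0 <= c ->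
  \sum_i Num.max (a i - c) 0 <= Num.max (\sum_i a i - c) 0.
Proof.
move=> a0 c0.
suff [_] : 0 <= \sum_i a i /\
  \sum_i Num.max (a i - c) 0 <= Num.max (\sum_i a i - c) 0 by [].
elim/big_rec2 : _ => [|i y1 y2 _ [y10 IH]].
  by split => //; rewrite le_max lexx orbT.
split; first exact: addr_ge0.
have := a0 i; move: IH; rewrite le_max.
case: (leP (a i - c) 0); case: (leP (y1 - c) 0) => h1 h2;
  rewrite ?lexx ?orbT le_max => /orP[|] h3 h4; apply/orP; lra.
Qed.

Section flow_average.
Context d (T : measurableType d) (R : realType) (P : probability T R).
Local Notation RR := (measurableTypeR R).
Context (F : R -> T -> T).
Hypothesis mF : measurable_fun [set: T * RR] (fun p => F p.2 p.1).
Hypothesis FP : forall t, mpres P P (F t).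
Implicit Types (e : T -> R) (w : RR -> R).

Lemma bmeas_flow e t : bmeas e -> bmeas (fun x => e (F t x)).
Proof. by move=> be; apply: bmeas_comp be (FP t).1. Qed.

Lemma mean_flow e t : bmeas e -> mean P (fun x => e (F t x)) = mean P e.
Proof. exact: (FP t).2. Qed.

Lemma bmeas_flow2 e : bmeas e -> bmeas (fun p : T * RR => e (F p.2 p.1)).
Proof. by move=> be; apply: bmeas_comp be mF. Qed.

Definition average w e (x : T) := mean (unif R) (fun y => w y * e (F y x)).

Lemma bmeas_average_fun w e : bmeas w -> bmeas e ->
  bmeas (fun p : T * RR => w p.2 * e (F p.2 p.1)).
Proof.
move=> bw be; apply: bmeasM; last exact: bmeas_flow2.
by apply: bmeas_comp bw _; exact: measurable_snd.
Qed.

Lemma bmeas_average w e : bmeas w -> bmeas e -> bmeas (average w e).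
Proof.
by move=> bw be; exact: (bmeas_mean1 P (unif R) (bmeas_average_fun bw be)).
Qed.

Lemma bmeas_orbit e x : bmeas e -> bmeas (fun y : RR => e (F y x)).
Proof. by move=> be; exact: (bmeas_pair1 x (bmeas_flow2 be)). Qed.

Lemma mean_average w e : bmeas w -> bmeas e ->
  mean P (average w e) = mean (unif R) w * mean P e.
Proof.
move=> bw be.
rewrite (mean_exchange P (unif R) (bmeas_average_fun bw be))/= mulrC -meanZ//.
by apply: eq_mean => y; rewrite meanZ ?mean_flow 1?mulrC//; exact: bmeas_flow.
Qed.

Lemma mean_norm_average e : bmeas e ->
  mean P (fun x => `|average (cst 1) e x|) <= mean P (fun x => `|e x|).
Proof.
move=> be; have b1 : bmeas (cst 1 : RR -> R) by exact: bmeas_cst.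
have bne := bmeas_norm be.
apply: (@le_trans _ _ (mean P (average (cst 1) (fun x => `|e x|)))).
  apply: le_mean; [exact/bmeas_norm/bmeas_average|exact: bmeas_average|].
  move=> x; apply: le_trans (le_norm_mean _ _) _.
    by apply: bmeasM => //; exact: bmeas_orbit.
  rewrite le_eqVlt; apply/orP; left; apply/eqP; apply: eq_mean => y.
  by rewrite !mul1r.
by rewrite mean_average// mean_cst mul1r.
Qed.

End flow_average.

(** The argument for a flow that carries functions [phi j] with values in [[-1, 1]],
uncorrelated for distinct indices or for times at distance at least [1], but
positively correlated with their own translates over short times.
Translates of [f] at close times cannot be told apart by the [phi j], so
[correlation_bound] does not apply to [f] directly. Both sides of the
approximation are averaged over a unit of time. Rounding the times [t k] down to
multiples [pos k / 8] and dropping the first eighth of the window gives a single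
function [fhat] whose translates stay below the averaged translates of [f]
([fhat_le]) and keep 7/8 of their mass. The sum [H j] of these translates
inherits the upper bound [2] of the averaged target up to [eps] ([excess]), and
it loses little of the correlation with [phi j] ([H_corr]). Grouped by rounded
time, and separately for each residue modulo [8], the translates of [phi j] are
orthogonal. *)
Section no_common_approximation.
Context d (T : measurableType d) (R : realType) (P : probability T R).
Local Notation RR := (measurableTypeR R).
Context (F : R -> T -> T).
Hypothesis F0 : forall x, F 0 x = x.
Hypothesis FD : forall s t x, F (s + t) x = F s (F t x).
Hypothesis mF : measurable_fun [set: T * RR] (fun p => F p.2 p.1).
Hypothesis FP : forall t, mpres P P (F t).
Context (n : nat) (phi : 'I_n -> T -> R).
Hypothesis bphi : forall j, bmeas (phi j).
Hypothesis phi1 : forall j x, `|phi j x| <= 1.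
Hypothesis phi0 : forall j, mean P (phi j) = 0.
Hypothesis phi_orth : forall i j s t, i != j \/ 1 <= `|s - t| ->
  mean P (fun x => phi i (F s x) * phi j (F t x)) = 0.
Hypothesis phi_corr : forall j, 4^-1 <=
  mean (unif R) (fun y => mean P (fun x => phi j (F y x) * phi j x)).
Context (m : nat) (f : T -> R) (t : 'I_m -> R) (lam : 'I_n -> 'I_m -> R).
Context (eps : R).
Hypothesis bf : bmeas f.
Hypothesis f0 : forall x, 0 <= f x.
Hypothesis lam0 : forall j k, 0 <= lam j k.
Hypothesis approx : forall j, mean P (fun x =>
  `|1 + phi j x - \sum_k lam j k * f (F (t k) x)|) <= eps.

Let S j x := \sum_k lam j k * f (F (t k) x).
Let e j x := 1 + phi j x - S j x.
Let avg := average F (cst 1).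
Let late : RR -> R := \1_(`[8^-1, +oo[%classic : set RR).
Let fhat := average F late f.
Let pos k : int := Num.floor (8 * t k).
Let H j x := \sum_k lam j k * fhat (F ((pos k)%:~R / 8) x).
Let b1 : bmeas (cst 1 : RR -> R). Proof. exact: bmeas_cst. Qed.

Let blate : bmeas late. Proof. exact: bmeas_indic. Qed.

Let late01 y : 0 <= late y <= 1.
Proof. by rewrite /late indicE; case: (_ \in _); rewrite ?lexx ler01. Qed.

Let bS j : bmeas (S j).
Proof. by apply: bmeas_sum => k; apply: bmeasZ; exact: (bmeas_flow FP). Qed.

Let bS1 j : bmeas (fun x => 1 + phi j x).
Proof. by apply: bmeasD => //; exact: bmeas_cst. Qed.

Let be j : bmeas (e j).
Proof. by apply: bmeasB. Qed.

Let bavg g : bmeas g -> bmeas (avg g).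
Proof. by move=> bg; exact: bmeas_average. Qed.

Let bfhat : bmeas fhat.
Proof. by exact: bmeas_average. Qed.

Let fhat0 x : 0 <= fhat x.
Proof.
by apply: mean_ge0 => y; rewrite mulr_ge0//; case/andP : (late01 y).
Qed.

Let bH j : bmeas (H j).
Proof. by apply: bmeas_sum => k; apply: bmeasZ; exact: (bmeas_flow FP). Qed.

Let mean_sum_flow g (r : 'I_m -> R) j : bmeas g ->
  mean P (fun x => \sum_k lam j k * g (F (r k) x)) = \sum_k lam j k * mean P g.
Proof.
move=> bg; rewrite mean_sum => [|k]; last by apply: bmeasZ; exact: (bmeas_flow FP).
by apply: eq_bigr => k _; rewrite meanZ ?(mean_flow FP)//; exact: (bmeas_flow FP).
Qed.

Let mean_S j : mean P (S j) = \sum_k lam j k * mean P f.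
Proof. exact: mean_sum_flow. Qed.

(* Integrating the approximation: the target [1 + phi j] has mean [1]. *)
Let mass j : \sum_k lam j k * mean P f <= 1 + eps /\
  1 - eps <= \sum_k lam j k * mean P f.
Proof.
have := le_trans (le_norm_mean P (be j)) (approx j).
rewrite /e meanB// meanD//; last exact: bmeas_cst.
rewrite mean_cst phi0 mean_S ler_norml; lra.
Qed.

Let mean_late : mean (unif R) late = 7 / 8.
Proof.
have -> : mean (unif R) late =
    mean (unif R) (fun y => 1 - (\1_(`]-oo, 8^-1[%classic : set RR) : RR -> R) y).
  apply: eq_mean => y; rewrite /late !indicE.
  rewrite -setCitvl in_setC.
  by case: (_ \in _); rewrite ?subrr ?subr0.
rewrite meanB; [|exact: bmeas_cst|exact: bmeas_indic].
rewrite mean_cst mean_unif_below; lra.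
Qed.

Let mean_fhat : mean P fhat = 7 / 8 * mean P f.
Proof. by rewrite (mean_average mF FP)// mean_late. Qed.

Let mean_H j : mean P (H j) = 7 / 8 * \sum_k lam j k * mean P f.
Proof.
rewrite mean_sum_flow// mean_fhat mulr_sumr.
by apply: eq_bigr => k _; rewrite mulrCA.
Qed.

Let avg1 g x : avg g x = mean (unif R) (fun y => g (F y x)).
Proof. by apply: eq_mean => y; rewrite mul1r. Qed.

Let bo k x : bmeas (fun y : RR => f (F (t k) (F y x))).
Proof. exact: (bmeas_orbit mF x (bmeas_flow FP (t k) bf)). Qed.

Let avg_sum j x : avg (S j) x = \sum_k lam j k * avg (fun x => f (F (t k) x)) x.
Proof.
rewrite avg1 mean_sum => [|k]; last exact: bmeasZ.
by apply: eq_bigr => k _; rewrite avg1 meanZ.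
Qed.

(* [t k] exceeds its rounding by less than [1/8], so [mean_unif_window] applies. *)
Let fhat_le k x : fhat (F ((pos k)%:~R / 8) x) <= avg (fun x => f (F (t k) x)) x.
Proof.
pose s := t k - (pos k)%:~R / 8.
have s8 : 0 <= s <= 8^-1.
  by have := floor_itv (8 * t k); rewrite /s -/(pos k) intrD; lra.
have /(_ s8) := @mean_unif_window R 8^-1 s _ (bo k x) (fun y => f0 _).
move=> /(_ ltac:(lra)); congr (_ <= _).
  apply: eq_mean => y; congr (_ * f _); rewrite -!FD; congr (F _ x).
  rewrite /s; lra.
by apply: eq_mean => y; rewrite /cst mul1r.
Qed.

Let H_le j x : H j x <= avg (S j) x.
Proof. by rewrite avg_sum; apply: ler_sum => k _; rewrite ler_wpM2l. Qed.

Let avgE j x : avg (e j) x = avg (fun x => 1 + phi j x) x - avg (S j) x.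
Proof.
rewrite !avg1 -meanB//; first exact: (bmeas_orbit mF x (bS1 j)).
exact: (bmeas_orbit mF x (bS j)).
Qed.

Let norm_avg j : mean P (fun x => `|avg (e j) x|) <= eps.
Proof. by apply: le_trans (approx j); exact: (mean_norm_average mF FP). Qed.

Let excess j : mean P (fun x => Num.max (H j x - 2) 0) <= eps.
Proof.
apply: le_trans (norm_avg j); apply: le_mean.
- by apply: bmeas_max; [apply: bmeasB => //|]; exact: bmeas_cst.
- exact/bmeas_norm/bavg.
- move=> x; rewrite ge_max normr_ge0 andbT.
  have le2 : avg (fun x => 1 + phi j x) x <= 2.
    rewrite avg1 -[leRHS](mean_cst (unif R)); apply: le_mean.
    + exact: (bmeas_orbit mF x (bS1 j)).
    + exact: bmeas_cst.
    + move=> y; have := phi1 j (F y x); rewrite ler_norml; lra.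
  rewrite -normrN; apply: le_trans (ler_norm _); rewrite avgE.
  have := H_le j x; lra.
Qed.

(* The average of the target has correlation at least [1/4] with [phi j]; the
   approximation costs [eps] and the dropped eighth at most [(1 + eps) / 8]. *)
Let H_corr j : 8^-1 - 9 / 8 * eps <= mean P (fun x => H j x * phi j x).
Proof.
have -> : mean P (fun x => H j x * phi j x) =
    mean P (fun x => avg (fun x => 1 + phi j x) x * phi j x) -
    mean P (fun x => avg (e j) x * phi j x) -
    mean P (fun x => (avg (S j) x - H j x) * phi j x).
  have bp g : bmeas g -> bmeas (fun x => g x * phi j x).
    by move=> bg; exact: bmeasM.
  have ba := bp _ (bavg (bS1 j)); have bb := bp _ (bavg (be j)).
  have bc := bp _ (bmeasB (bavg (bS j)) (bH j)).
  rewrite -!meanB//; last exact: bmeasB.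
  by apply: eq_mean => x; rewrite avgE; ring.
have h1 : 4^-1 <= mean P (fun x => avg (fun x => 1 + phi j x) x * phi j x).
  apply: le_trans (phi_corr j) _; rewrite le_eqVlt; apply/orP; left; apply/eqP.
  have bb : bmeas (fun p : T * RR => (1 + phi j (F p.2 p.1)) * phi j p.1).
    apply: bmeasM; first exact: (bmeas_flow2 mF (bS1 j)).
    by apply: bmeas_comp (bphi j) _; exact: measurable_fst.
  transitivity (mean P (fun x => mean (unif R)
      (fun y => (1 + phi j (F y x)) * phi j x))).
    rewrite (mean_exchange P (unif R) bb)/=; apply: eq_mean => y.
    rewrite -[LHS]add0r -(phi0 j) -meanD//.
      by apply: eq_mean => x; ring.
    by apply: bmeasM => //; exact: (bmeas_flow FP y (bphi j)).
  apply: eq_mean => x; rewrite avg1 mulrC -meanZ.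
    by apply: eq_mean => y; rewrite mulrC.
  exact: (bmeas_orbit mF x (bS1 j)).
have h2 : mean P (fun x => avg (e j) x * phi j x) <= eps.
  apply: le_trans (norm_avg j); apply: le_mean.
  - by apply: bmeasM => //; exact: bavg.
  - exact/bmeas_norm/bavg.
  - move=> x; apply: le_trans (ler_norm _) _; rewrite normrM.
    by rewrite ler_piMr.
have h3 : mean P (fun x => (avg (S j) x - H j x) * phi j x) <= (1 + eps) / 8.
  apply: (@le_trans _ _ (mean P (fun x => avg (S j) x - H j x))).
    apply: le_mean.
    - by apply: bmeasM => //; apply: bmeasB => //; exact: bavg.
    - by apply: bmeasB => //; exact: bavg.
    - move=> x; rewrite ler_piMr ?subr_ge0//.
      exact: le_trans (ler_norm _) _.
  rewrite meanB//; last exact: bavg.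
  rewrite (mean_average mF FP)// mean_cst mul1r.
  rewrite mean_S mean_H; have [+ _] := mass j.
  by move: (\sum_k _) => u; lra.
move: h1 h2 h3; move: (mean P _) (mean P _) (mean P _) => u v w; lra.
Qed.

(* Rounded times are indexed by an ordinal through the offset [M]. *)
Let M := (\sum_k `|pos k|).+1%N.
Let L := (M + M)%N.
Let idx k : 'I_L.+1 := inord `|(pos k + M%:Z)%R|%N.
Let shift (i : 'I_L.+1) : R := ((i : nat)%:R - M%:R) / 8.
Let Lam (a : 'I_n * 'I_L.+1) := \sum_(k | idx k == a.2) lam a.1 k.
Let psi (a : 'I_n * 'I_L.+1) x := phi a.1 (F (- shift a.2) x).
Let residue (a : 'I_n * 'I_L.+1) : 'I_8 := inord (a.2 %% 8)%N.

Let idxE k : shift (idx k) = (pos k)%:~R / 8.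
Proof.
have pM : (`|pos k| < M)%N by rewrite /M (bigD1 k)//= ltnS leq_addr.
rewrite /shift /idx inordK; last by move: pM; rewrite /L; lia.
congr (_ / _); have -> : M%:R = M%:Z%:~R :> R by [].
have -> : `|(pos k + M%:Z)%R|%N%:R = `|(pos k + M%:Z)%R|%N%:Z%:~R :> R by [].
by rewrite -intrB; congr (_%:~R); lia.
Qed.

Let HE j x : H j x = \sum_i Lam (j, i) * fhat (F (shift i) x).
Proof.
rewrite /H (partition_big idx predT)//=; apply: eq_bigr => i _.
by rewrite mulr_suml; apply: eq_bigr => k /eqP <-; rewrite idxE.
Qed.

Let Lam0 a : 0 <= Lam a.
Proof. exact: sumr_ge0. Qed.

Let bpsi a : bmeas (psi a).
Proof. exact: (bmeas_flow FP). Qed.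

Let psi_orth r a b : residue a == r -> residue b == r -> a != b ->
  mean P (fun x => psi a x * psi b x) = 0.
Proof.
case: a b => [j i] [j' i'] /eqP ar /eqP br ab; apply: phi_orth => /=.
have [jj|_] := eqVneq j j'; last by left.
right; move: ab; rewrite jj xpair_eqE eqxx/= => ii.
have {ar br} : (i %% 8 = i' %% 8)%N.
  have := congr1 val (etrans ar (esym br)).
  by rewrite /residue/= !inordK// ltn_pmod.
have {ii} : (i : nat) <> i' by apply/eqP.
rewrite /shift; move: (i : nat) (i' : nat) => u v uv uv8.
have /orP[] : ((u + 8 <= v) || (v + 8 <= u))%N by lia.
  by rewrite -(ler_nat R) natrD ler_normr => h; apply/orP; left; lra.
by rewrite -(ler_nat R) natrD ler_normr => h; apply/orP; right; lra.
Qed.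

Let H_psi j :
  mean P (fun x => H j x * phi j x) =
  \sum_i Lam (j, i) * mean P (fun x => fhat x * psi (j, i) x).
Proof.
have bg i : bmeas (fun x => fhat x * psi (j, i) x) by exact: bmeasM.
transitivity (mean P (fun x => \sum_i Lam (j, i) *
    (fhat (F (shift i) x) * psi (j, i) (F (shift i) x)))).
  apply: eq_mean => x; rewrite HE mulr_suml; apply: eq_bigr => i _.
  by rewrite /psi/= -FD addNr F0 mulrA.
rewrite mean_sum => [|i]; last exact/bmeasZ/(bmeas_flow FP (shift i) (bg i)).
apply: eq_bigr => i _; rewrite meanZ; last exact: (bmeas_flow FP (shift i) (bg i)).
by rewrite (mean_flow FP (shift i) (bg i)).
Qed.

Let excess_fhat j :
  \sum_i mean P (fun x => Num.max (Lam (j, i) * fhat x - 2) 0) <= eps.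
Proof.
have bg i : bmeas (fun x => Num.max (Lam (j, i) * fhat x - 2) 0).
  by apply: bmeas_max; [apply: bmeasB; [exact: bmeasZ|]|]; exact: bmeas_cst.
have bgF i := bmeas_flow FP (shift i) (bg i).
apply: le_trans (excess j).
under eq_bigr => i _ do rewrite -(mean_flow FP (shift i) (bg i)).
rewrite -mean_sum//; apply: le_mean.
- exact: bmeas_sum.
- by apply: bmeas_max; [apply: bmeasB|]=> //; exact: bmeas_cst.
- move=> x; rewrite HE; apply: sum_excess_le => // i.
  by rewrite mulr_ge0.
Qed.

Let mass_fhat j : \sum_i Lam (j, i) * mean P fhat <= 1 + eps.
Proof.
have -> : \sum_i Lam (j, i) * mean P fhat = mean P (H j).
  rewrite mean_H mulr_sumr (partition_big idx predT)//=.
  apply: eq_bigr => i _; rewrite mulr_suml; apply: eq_bigr => k _.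
  by rewrite mean_fhat mulrCA.
by rewrite mean_H; have [] := mass j; lra.
Qed.

(** The correlations of the [n] sums [H j] add up to about [n / 8], whereas
[correlation_bound], applied to the eight residues with [eta] and [sigma] equal
to [n / 400], gives at most [n / 25 + 6400 * n * eps + 3200]. *)
Lemma no_common_approximation : 10 ^+ 5 <= n%:R :> R -> eps <= 10 ^- 6 -> False.
Proof.
move=> hn heps.
have n0 : 0 < n%:R :> R by apply: lt_le_trans hn; rewrite exprn_gt0.
pose j0 : 'I_n := Ordinal (n := n) (m := 0) ltac:(by rewrite -(ltr0n R)).
have eps0 : 0 <= eps.
  by apply: le_trans (norm_avg j0); exact: mean_ge0.
have fhat_gt0 : 0 < mean P fhat.
  rewrite mean_fhat mulr_gt0// lt_neqAle mean_ge0// andbT; apply/negP => /eqP f00.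
  have [_] := mass j0; rewrite -f00 big1 => [|k _]; last by rewrite mulr0.
  by move: heps; lra.
have lower : n%:R * (8^-1 - 9 / 8 * eps) <=
    \sum_a Lam a * mean P (fun x => fhat x * psi a x).
  rewrite (eq_bigr (fun a => Lam (a.1, a.2) * mean P (fun x => fhat x * psi (a.1, a.2) x)));
    last by move=> [].
  rewrite -(pair_bigA _ (fun j i => Lam (j, i) * mean P (fun x => fhat x * psi (j, i) x)))/=.
  rewrite mulr_natl -[n in _ *+ n]card_ord -sumr_const; apply: ler_sum => j _.
  by rewrite -H_psi; exact: H_corr.
have total (G : 'I_n * 'I_L.+1 -> R) c : (forall j, \sum_i G (j, i) <= c) ->
    \sum_a G a <= n%:R * c.
  move=> Gc; rewrite (eq_bigr (fun a => G (a.1, a.2))); last by move=> [].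
  rewrite -(pair_bigA _ (fun j i => G (j, i)))/=.
  by rewrite mulr_natl -[n in _ *+ n]card_ord -sumr_const; exact: ler_sum.
pose eta : R := n%:R / 400.
have eta0 : 0 < eta by apply: (divr_gt0 n0); rewrite ltr0n.
have upper r : \sum_(a | residue a == r) Lam a * mean P (fun x => fhat x * psi a x)
    <= eta + (2 * n%:R) * (n%:R * eps) / eta + eta + (2 * n%:R) / (2 * eta).
  apply: correlation_bound => //.
  - by move=> j x; exact: phi1.
  - exact: psi_orth.
  - by rewrite mulr_ge0// ltW.
  - apply: (@le_trans _ _ (\sum_a Lam a * mean P fhat)).
      rewrite [leRHS](bigID (fun a => residue a == r))/= lerDl sumr_ge0// => a _.
      by rewrite mulr_ge0// ltW.
    apply: le_trans (total (fun a => Lam a * mean P fhat) _ mass_fhat) _.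
    rewrite mulrC ler_wpM2r ?(ltW n0)//; lra.
  - apply: le_trans (total (fun a =>
      mean P (fun x => Num.max (Lam a * fhat x - 2) 0)) eps excess_fhat).
    rewrite [leRHS](bigID (fun a => residue a == r))/= lerDl sumr_ge0// => a _.
    by apply: mean_ge0 => x; rewrite le_max lexx orbT.
have : \sum_a Lam a * mean P (fun x => fhat x * psi a x) <=
    \sum_(r < 8) (eta + (2 * n%:R) * (n%:R * eps) / eta + eta + (2 * n%:R) / (2 * eta)).
  by rewrite (partition_big residue predT)//=; exact: ler_sum.
rewrite sumr_const card_ord.
have -> : (2 * n%:R) * (n%:R * eps) / eta = 800 * (n%:R * eps).
  by rewrite /eta; field; rewrite gt_eqF.
have -> : (2 * n%:R) / (2 * eta) = 400 :> R.
  by rewrite /eta; field; rewrite gt_eqF.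
have : n%:R * eps <= n%:R * 10 ^- 6 by rewrite ler_wpM2l// ltW.
move: lower hn; rewrite /eta; lra.
Qed.

End no_common_approximation.

(** * Flows that preserve a probability measure *)

Section measure_preserving_flow.
Context d (T : measurableType d) (R : realType) (P : probability T R).
Local Notation RR := (measurableTypeR R).
Context (F : R -> T -> T).
Hypothesis F0 : forall x, F 0 x = x.
Hypothesis FD : forall s t x, F (s + t) x = F s (F t x).
Hypothesis mF : measurable_fun [set: T * RR] (fun p => F p.2 p.1).
Hypothesis FP : forall t, mpres P P (F t).

Lemma flowK t : cancel (F t) (F (- t)).
Proof. by move=> x; rewrite -FD addNr F0. Qed.

Lemma flowNK t : cancel (F (- t)) (F t).
Proof. by move=> x; rewrite -FD subrr F0. Qed.

Lemma flow_image t A : F t @` A = F (- t) @^-1` A.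
Proof.
apply/seteqP; split => [_ [x Ax <-]|x Ax]; first by rewrite /= flowK.
by exists (F (- t) x) => //; rewrite flowNK.
Qed.

Lemma measurable_flow_preimage t A : measurable A -> measurable (F t @^-1` A).
Proof. by move=> mA; rewrite -[X in measurable X]setTI; exact: (FP t).1. Qed.

Lemma flow_measure t A : measurable A -> P (F t @^-1` A) = P A.
Proof. exact: mpres_set. Qed.

Lemma mpres_is_flow : is_flow P F.
Proof.
split => // t; split.
- by exists (F (- t)); [exact: flowK|exact: flowNK].
- exact: (FP t).1.
- by move=> A mA; rewrite flow_image; exact: measurable_flow_preimage.
- move=> A mA; have e := flow_measure t mA.
  by split => h; [exact: etrans (esym e) h|exact: etrans e h].
Qed.

(** Let [delta] be the logarithm of [N + 1]. If [Lambda F delta s A] had measure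
less than half of [A], the rest [A'] of [A] would have no return to [A] at any
time between [expR s] and [N * expR s]. Its preimages at the times
[i * expR s], [i < N], would be disjoint and of equal measure, which is
impossible once [N] times the measure of [A'] exceeds [1]. *)
Lemma mpres_not_property_B : ~ property_B P F.
Proof.
move=> [A [mA A0 AB]].
pose p := fine (P A).
have pE : P A = p%:E by rewrite fineK// fin_num_measure.
have p0 : 0 < p by rewrite -lte_fin -pE.
pose N := (Num.truncn (2 / p)).+1.
have Np : 1 < N%:R * (p / 2).
  rewrite -ltr_pdivrMr ?divr_gt0// invf_div mul1r.
  exact: truncnS_gt.
pose delta : R := ln (N.+1)%:R.
have delta0 : 0 < delta by rewrite ln_gt0// ltr1n.
have := AB _ delta0; rewrite /limf_esup => h0.
have : (ereal_inf [set ereal_sup [set mu_ext P (Lambda F delta s A) | s in V]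
    | V in +oo%R] < (p / 2)%:E)%E.
  by rewrite h0 lte_fin divr_gt0.
move=> /ereal_inf_lt[_ [V [b [_ bV]] <-]] hV.
have [s bs] : exists s, b < s by exists (b + 1); rewrite ltrDl.
have : (mu_ext P (Lambda F delta s A) < (p / 2)%:E)%E.
  apply: le_lt_trans hV; apply: ereal_sup_ubound; exists s => //.
  exact: bV.
move=> /ereal_inf_lt[_ [C [mC CL] <-]] hC.
(* [L] is a measurable set that contains [Lambda F delta s A]. *)
pose L := \bigcup_k C k.
have mL : measurable L by exact: bigcupT_measurable.
have PL : (P L < (p / 2)%:E)%E.
  by apply: le_lt_trans hC; exact: generalized_Boole_inequality.
pose A' := A `\` L.
have mA' : measurable A' by exact: measurableD.
have hA' : p / 2 <= mean P \1_A'.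
  have PAL : (P (A `&` L) <= (p / 2)%:E)%E.
    apply: le_trans (ltW PL); apply: le_measure; rewrite ?inE//.
    exact: measurableI.
  have PAoo : (P A < +oo)%E by rewrite pE ltry.
  have PAp : (p%:E <= P A)%E by rewrite pE.
  rewrite -lee_fin mean_indic// /A' measureD//.
  have -> : (p / 2)%:E = (p%:E - (p / 2)%:E)%E by rewrite -EFinB; congr EFin; lra.
  exact: leeB.
have disj (i j : 'I_N) x : (i < j)%N -> A' (F (i%:R * expR s) x) ->
    ~ A' (F (j%:R * expR s) x).
  move=> ij [Ai nL] [Aj _]; apply: nL; apply: CL; split => //.
  exists ((j - i)%N%:R * expR s); last first.
    by rewrite -FD -mulrDl -natrD subnK// ltnW.
  left; rewrite /= in_itv/= !expRD expRN /delta lnK ?posrE//.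
  have es := expR_gt0 s.
  rewrite ![expR s * _]mulrC !ltr_pM2r//; apply/andP; split.
    apply: (@lt_le_trans _ _ 1); last by rewrite ler1n subn_gt0.
    by rewrite invf_lt1// ltr1n.
  by rewrite ltr_nat ltnS (leq_trans (leq_subr _ _))// ltnW.
pose u (i : 'I_N) (x : T) : R := \1_A' (F (i%:R * expR s) x).
have bu i : bmeas (u i) by apply: (bmeas_flow FP); exact: bmeas_indic.
have : mean P (fun x => \sum_i u i x) <= 1.
  rewrite -[leRHS](mean_cst P); apply: le_mean.
  - exact: bmeas_sum.
  - exact: bmeas_cst.
  - move=> x; case: (pickP (fun i => u i x != 0)) => [i ui|u0]; last first.
      by rewrite big1 ?ler01// => i _; apply/eqP; rewrite -[_ == _]negbK u0.
    have {ui} Ai : A' (F (i%:R * expR s) x).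
      by move: ui; rewrite /u indicE; case: (boolP (_ \in _)) => [/set_mem//|]; rewrite eqxx.
    rewrite (bigD1 i)//= big1 ?addr0 => [|j ji].
      by rewrite /u indicE; case: (_ \in _).
    rewrite /u indicE memNset// => Aj.
    move: ji; rewrite -val_eqE/= neq_ltn => /orP[ji|ij].
      exact: disj ji Aj Ai.
    exact: disj ij Ai Aj.
rewrite mean_sum//.
rewrite (eq_bigr (fun=> mean P \1_A')) => [|i _]; last first.
  exact: (mean_flow FP _ (bmeas_indic R mA')).
rewrite sumr_const card_ord -mulr_natl => h.
have : N%:R * (p / 2) <= N%:R * mean P \1_A' by rewrite ler_wpM2l.
lra.
Qed.

Lemma mpres_RN_derivative t :
  measurable_fun setT (RN_derivative P (fun A => P (F t @` A))) /\
  ae_eq P setT (RN_derivative P (fun A => P (F t @` A))) (cst 1%E).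
Proof.
set nu := fun A => P (F t @` A).
have : is_RN_derivative P nu (RN_derivative P nu).
  rewrite /RN_derivative; case: xgetP => [g _ //|/(_ (cst 1%E))]; case.
  split => // A mA.
  by rewrite /nu flow_image flow_measure// integral_cst// mul1e.
move=> [mg g0 gE]; split => //; apply/ae_eq_sym; apply: integral_ae_eq => //.
  exact: finite_measure_integrable_cst.
move=> E _ mE; rewrite -gE// /nu flow_image flow_measure//.
by rewrite integral_cst// mul1e.
Qed.

Lemma integral_flow t (h : T -> \bar R) : measurable_fun setT h ->
  (forall x, 0 <= h x)%E -> (\int[P]_x h (F t x) = \int[P]_x h x)%E.
Proof.
move=> mh h0.
pose nu' : {measure set T -> \bar R} := pushforward P (F t).
pose nu := nu' (FP t).1.
transitivity (\int[nu]_x h x)%E.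
  by rewrite /nu /nu' ge0_integral_pushforward//; exact: (FP t).1.
by apply: eq_measure_integral => A mA _; exact: flow_measure.
Qed.

(** Approximate transitivity provides an integrable [f], while the estimates above
are made for bounded functions. *)
Lemma truncation (f : T -> R) (eta : R) : 0 < eta -> L1_nonneg P f ->
  exists2 c : R, 0 <= c & (\int[P]_x (f x - Num.min (f x) c)%:E <= eta%:E)%E.
Proof.
move=> eta0 [fi f0].
have mf : measurable_fun setT f by apply/measurable_EFinP; case/integrableP : fi.
pose D n x : \bar R := (f x - Num.min (f x) n%:R)%:E.
have mD n : measurable_fun setT (D n).
  by apply/measurable_EFinP; apply: measurable_funB => //; exact: measurable_minr.
have D0 n x : (0 <= D n x)%E.
  by rewrite lee_fin subr_ge0 ge_min lexx.
have cvgD : {ae P, forall x, setT x -> D ^~ x @ \oo --> (cst 0%E x : \bar R)}.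
  apply: aeW => x _; apply: (@cvg_near_cst _ _ _ _ _ _).
  near=> n; rewrite /D min_l ?subrr//.
  near: n; exact: nbhs_infty_ger.
have bD : {ae P, forall x n, setT x -> (`|D n x| <= (f x)%:E)%E}.
  apply: aeW => x n _; rewrite gee0_abs// lee_fin gerBl le_min f0/=.
  exact: ler0n.
have [_ _] := dominated_convergence measurableT mD (measurable_cst _) cvgD fi bD.
rewrite integral0 => h.
have eta0' : (0 < eta%:E)%E by rewrite lte_fin.
have [N _ /(_ N (leqnn N)) /= hN] := h _ (open_ereal_lt' eta0').
by exists N%:R; [exact: ler0n|exact: ltW].
Unshelve. all: by end_near. Qed.

Lemma approx_truncated (m : nat) (phi f : T -> R) (t : 'I_m -> R) (lam : 'I_m -> R)
    (c eps eta : R) :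
    bmeas phi -> L1_nonneg P f -> 0 <= c -> (forall k, 0 <= lam k) ->
    (Lnorm P 1 (fun x => (1 + phi x)%:E - \sum_(k < m) (lam k)%:E *
       ((f (F (t k) x))%:E * RN_derivative P (fun A => P (F (t k) @` A)) x)) <=
     eps%:E)%E ->
    (\int[P]_x (f x - Num.min (f x) c)%:E <= eta%:E)%E ->
  mean P (fun x => `|1 + phi x - \sum_k lam k * Num.min (f (F (t k) x)) c|) <=
  eps + (\sum_k lam k) * eta.
Proof.
move=> bphi [fi f0] c0 lam0 happ heta.
have mf : measurable_fun setT f by apply/measurable_EFinP; case/integrableP : fi.
have mfF k : measurable_fun setT (fun x => f (F (t k) x)).
  by apply: measurableT_comp => //; exact: (FP (t k)).1.
have mfFE k : measurable_fun setT (fun x => (f (F (t k) x))%:E).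
  exact: measurableT_comp.
pose g x := 1 + phi x - \sum_k lam k * f (F (t k) x).
have mg : measurable_fun setT g.
  apply: measurable_funB; first by apply: measurable_funD => //; case: bphi.
  by apply: measurable_sum => k; exact: measurable_funM.
have mgE : measurable_fun setT (fun x => (g x)%:E) by exact: measurableT_comp.
have mgA : measurable_fun setT (fun x => `|(g x)%:E|%E) by exact: measurableT_comp.
have hg : (\int[P]_x `|(g x)%:E| <= eps%:E)%E.
  apply: le_trans happ; rewrite Lnorm1 le_eqVlt; apply/orP; left; apply/eqP.
  pose RN k := RN_derivative P (fun A => P (F (t k) @` A)).
  have mRN k : measurable_fun setT (RN k) := (mpres_RN_derivative (t k)).1.
  have RN1 : {ae P, forall x, forall k : 'I_m, RN k x = 1%E}.
    apply: filter_forall => k; have [_] := mpres_RN_derivative (t k).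
    by apply: filterS => x; exact.
  apply: ge0_ae_eq_integral => //.
  - apply/measurableT_comp => //; apply: emeasurable_funB.
      by apply/measurable_EFinP; apply: measurable_funD => //; case: bphi.
    apply: emeasurable_sum => k; apply: emeasurable_funM => //.
    exact: (emeasurable_funM (mfFE k) (mRN k)).
  - apply: filterS RN1 => x RNx _; rewrite /g EFinB -sumEFin.
    congr (`|_ - _|)%E; apply: eq_bigr => k _.
    by rewrite -/(RN k x) RNx mule1 EFinM.
pose D x := f x - Num.min (f x) c.
have D0 x : 0 <= D x by rewrite subr_ge0 ge_min lexx.
have mD : measurable_fun setT D.
  by apply: measurable_funB => //; exact: measurable_minr.
have mDF k : measurable_fun setT (fun x => D (F (t k) x)).
  by apply: measurableT_comp => //; exact: (FP (t k)).1.
have mDE k : measurable_fun setT (fun x => (D (F (t k) x))%:E).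
  exact: measurableT_comp.
have bc : bmeas (fun x => Num.min (f x) c).
  split; first exact: measurable_minr.
  exists c => x; rewrite ger0_norm ?ge_min ?lexx ?orbT//.
  by rewrite le_min f0.
have bcF k : bmeas (fun x => lam k * Num.min (f (F (t k) x)) c).
  by apply: bmeasZ; exact: (bmeas_flow FP (t k) bc).
rewrite -lee_fin EFin_mean; last first.
  apply: bmeas_norm; apply: bmeasB; last exact: bmeas_sum.
  by apply: bmeasD => //; exact: bmeas_cst.
apply: (@le_trans _ _ (\int[P]_x (`|(g x)%:E| +
    \sum_(k < m) (lam k)%:E * (D (F (t k) x))%:E))%E).
  apply: ge0_le_integral => //.
  - apply/measurable_EFinP; apply: measurableT_comp => //.
    apply: measurable_funB; first by apply: measurable_funD => //; case: bphi.
    by apply: measurable_sum => k; case: (bcF k).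
  - apply: emeasurable_funD; first by [].
    by apply: emeasurable_sum => k; apply: emeasurable_funM.
  - move=> x _; under [X in (_ <= _ + X)%E]eq_bigr do rewrite -EFinM.
    rewrite sumEFin -EFinD lee_fin.
    have -> : 1 + phi x - \sum_k lam k * Num.min (f (F (t k) x)) c =
        g x + \sum_(k < m) lam k * D (F (t k) x).
      have -> : \sum_(k < m) lam k * D (F (t k) x) =
          \sum_k lam k * f (F (t k) x) - \sum_k lam k * Num.min (f (F (t k) x)) c.
        by rewrite -sumrB; apply: eq_bigr => k _; rewrite /D; ring.
      by rewrite /g; ring.
    apply: le_trans (ler_normD _ _) _; rewrite lerD2l ger0_norm//.
    by apply: sumr_ge0 => k _; rewrite mulr_ge0.
rewrite ge0_integralD//; last 2 first.
- by move=> x _; apply: sume_ge0 => k _; rewrite mule_ge0// lee_fin.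
- by apply: emeasurable_sum => k; apply: emeasurable_funM.
rewrite EFinD leeD// ge0_integral_sum//; last 2 first.
- by move=> k; apply: emeasurable_funM.
- by move=> k x _; rewrite mule_ge0// lee_fin.
rewrite mulr_suml -sumEFin; apply: lee_sum => k _.
rewrite ge0_integralZl//; last 2 first.
- by move=> x _; rewrite lee_fin.
- by rewrite lee_fin.
rewrite EFinM lee_wpmul2l ?lee_fin//.
by rewrite (integral_flow (t k) (h := EFin \o D))//; exact: measurableT_comp.
Qed.

(** The targets are [1 + phi j] for [j < n]; half of the tolerance is kept for the
truncation of [f]. *)
Lemma mpres_not_approximately_transitive (phi : nat -> T -> R) :
    (forall j, bmeas (phi j)) -> (forall j x, `|phi j x| <= 1) ->
    (forall j, mean P (phi j) = 0) ->
    (forall i j s t, i != j \/ 1 <= `|s - t| ->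
      mean P (fun x => phi i (F s x) * phi j (F t x)) = 0) ->
    (forall j, 4^-1 <=
      mean (unif R) (fun y => mean P (fun x => phi j (F y x) * phi j x))) ->
  ~ approximately_transitive P F.
Proof.
move=> bphi phi1 phi0 orth corr AT.
pose n := (Num.truncn (10 ^+ 5 : R)).+1.
have hn : 10 ^+ 5 <= n%:R :> R by exact/ltW/truncnS_gt.
pose eps : R := 10 ^- 6.
have eps0 : 0 < eps by rewrite invr_gt0 exprn_gt0.
pose psi (j : 'I_n) x := 1 + phi j x.
have [|||f [m [t [lam [Lf _ lam0 happ]]]]] := AT n psi (eps / 2).
- by [].
- move=> j; split.
    by apply: bmeas_integrable; apply: bmeasD => //; exact: bmeas_cst.
  by move=> x; have := phi1 j x; rewrite ler_norml /psi; lra.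
- by rewrite divr_gt0.
pose w := \sum_j \sum_k lam j k.
have w0 : 0 <= w by apply: sumr_ge0 => j _; exact: sumr_ge0.
have eta0 : 0 < eps / 2 / (1 + w) by rewrite !divr_gt0// ltr_pwDl.
have [c c0 hc] := truncation eta0 Lf.
have mf : measurable_fun setT f.
  by apply/measurable_EFinP; case: Lf => /integrableP[].
apply: (@no_common_approximation _ _ _ P F F0 FD mF FP n (fun j => phi j)
  _ _ _ _ _ m (fun x => Num.min (f x) c) t lam eps) => //.
- by move=> i j s u ij; exact: orth.
- split; first exact: measurable_minr.
  exists c => x; rewrite ger0_norm ?ge_min ?lexx ?orbT//.
  by rewrite le_min Lf.2.
- by move=> x; rewrite le_min Lf.2.
- move=> j.
  apply: le_trans (approx_truncated (bphi j) Lf c0 (lam0 j) (happ j) hc) _.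
  have : \sum_k lam j k <= w.
    by rewrite /w (bigD1 j)//= lerDl; apply: sumr_ge0 => i _; exact: sumr_ge0.
  move=> lw; have : (\sum_k lam j k) * (eps / 2 / (1 + w)) <= eps / 2.
    by rewrite mulrA ler_pdivrMr ?ltr_pwDl// mulrC ler_wpM2l ?divr_ge0 ?(ltW eps0)//; lra.
  lra.
Qed.

End measure_preserving_flow.

(** * Ergodicity of the baker map *)

(** ** Extension of asymptotic independence from a generating pi-system *)

Section independence_extension.
Context d (T : measurableType d) (R : realType) (P : probability T R).

Lemma mean_bigcup_tail (F : (set T)^nat) : (forall i, measurable (F i)) ->
  trivIset setT F ->
  (fun n => mean P (fun x => \1_(\bigcup_i F i) x - \sum_(i < n) \1_(F i) x : R))
    @ \oo --> (0 : R).
Proof.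
move=> mF tF.
have mU : measurable (\bigcup_i F i) by exact: bigcupT_measurable.
have bF i : bmeas (\1_(F i) : T -> R) by exact: bmeas_indic.
have E n : mean P (fun x => \1_(\bigcup_i F i) x - \sum_(i < n) \1_(F i) x : R) =
    mean P \1_(\bigcup_i F i) - \sum_(i < n) mean P \1_(F i).
  rewrite meanB ?mean_sum//; [exact: bmeas_indic|exact: bmeas_sum].
under eq_fun do rewrite E.
have h := @measure_semi_sigma_additive _ T R P F mF tF mU.
suff /fine_cvgP[_ cv] : (fun n => (\sum_(i < n) mean P \1_(F i))%:E) @ \oo -->
    (mean P \1_(\bigcup_i F i))%:E.
  have := cvgB (cvg_cst (mean P \1_(\bigcup_i F i))) cv; rewrite subrr; exact.
rewrite mean_indic//; apply: cvg_trans h; apply: near_eq_cvg.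
apply: nearW => n; rewrite big_mkord -sumEFin.
by apply: eq_bigr => i _; rewrite mean_indic.
Qed.

(** The sets [B] for which the limit holds form a Dynkin class: the [g n] are
uniformly bounded, so a countable disjoint union can be cut at a finite stage
with an error that does not depend on [n]. It is used both for mixing and, with
a constant sequence, for plain independence. *)
Lemma independence_extension (G : set (set T)) (g : nat -> T -> R) (l M : R) :
    (measurable : set (set T)) = <<s G >> -> setI_closed G ->
    (forall n, bmeas (g n)) -> (forall n x, `|g n x| <= M) ->
    (fun n => mean P (g n)) @ \oo --> l ->
    (forall B, G B -> (fun n => mean P (fun x => \1_B x * g n x)) @ \oo -->
      mean P \1_B * l) ->
  forall B, measurable B -> (fun n => mean P (fun x => \1_B x * g n x)) @ \oo -->
    mean P \1_B * l.
Proof.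
move=> GE GI bg gM gl GP B mB.
have mG C : G C -> measurable C by rewrite GE => GC; exact: sub_sigma_algebra.
have b1 (C : set T) : measurable C -> bmeas (\1_C : T -> R) by exact: bmeas_indic.
have b1g C n : measurable C -> bmeas (fun x => \1_C x * g n x).
  by move=> mC; apply: bmeasM => //; exact: b1.
apply: (dynkin_induction (P := fun B => (fun n => mean P (fun x => \1_B x * g n x)) @ \oo -->
    mean P \1_B * l) GE GI) => //; last by rewrite -GE.
- have -> : mean P \1_[set: T] = 1.
    by rewrite -[RHS](mean_cst P); apply: eq_mean => x; rewrite indicT.
  rewrite mul1r (_ : (fun n => _) = (fun n => mean P (g n))).
    exact: gl.
  by apply/funext => n; apply: eq_mean => x; rewrite indicT mul1r.
- move=> C mC Cl.
  have -> : mean P \1_(~` C) * l = l - mean P \1_C * l.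
    rewrite -[X in X - _]mul1r -mulrBl; congr (_ * _).
    rewrite -[X in X - _](mean_cst P) -meanB; [|exact: bmeas_cst|exact: b1].
    by apply: eq_mean => x; rewrite !indicE in_setC; case: (_ \in _) => /=; lra.
  rewrite (_ : (fun n => _) = (fun n => mean P (g n) - mean P (fun x => \1_C x * g n x))).
    exact: cvgB.
  apply/funext => n; rewrite -meanB//; last exact: b1g.
  by apply: eq_mean => x; rewrite !indicE in_setC; case: (_ \in _) => /=; lra.
- move=> F mF tF Fl.
  have mU : measurable (\bigcup_i F i) by exact: bigcupT_measurable.
  have M0 : 0 <= M by apply: le_trans (gM 0%N point).
  pose tail n x : R := \1_(\bigcup_i F i) x - \sum_(i < n) \1_(F i) x.
  have btail n : bmeas (tail n).
    by apply: bmeasB; [exact: b1|apply: bmeas_sum => i; exact: b1].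
  have tail0 n x : 0 <= tail n x.
    rewrite /tail subr_ge0.
    case: (pickP (fun i : 'I_n => x \in F i)) => [i xi|nx]; last first.
      by rewrite big1 ?indicE// => i _; rewrite indicE nx.
    rewrite (bigD1 i)//= big1 ?addr0 => [|j ji].
      rewrite !indicE xi mem_set//; exists i => //; exact: set_mem.
    rewrite indicE memNset// => Fj; move: ji.
    have -> : j = i; last by rewrite eqxx.
    by apply/val_inj/(tF _ _ I I); exists x; split => //; exact: set_mem.
  apply/cvgrPdist_le => /= e e0.
  have := mean_bigcup_tail mF tF.
  have e1 : 0 < e / 2 / (M + `|l| + 1).
    by rewrite !divr_gt0// ltr_pwDr// addr_ge0.
  move=> /cvgrPdist_le /(_ _ e1) [N _ /(_ N (leqnn N))].
  rewrite sub0r normrN ger0_norm; last by apply: mean_ge0; exact: tail0.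
  rewrite -/(mean P (tail N)) => hN.
  have : (fun n => \sum_(i < N) mean P (fun x => \1_(F i) x * g n x)) @ \oo -->
      \sum_(i < N) (mean P \1_(F i) * l).
    elim: (index_enum _) => [|i r IH].
      by under eq_fun do rewrite big_nil; rewrite big_nil; exact: cvg_cst.
    under eq_fun do rewrite big_cons; rewrite big_cons.
    by apply: cvgD; [exact: Fl|exact: IH].
  have e2 : 0 < e / 2 by lra.
  move=> /cvgrPdist_le /(_ _ e2); apply: filterS => n hn.
  have E1 : mean P (fun x => \1_(\bigcup_i F i) x * g n x) =
      \sum_(i < N) mean P (fun x => \1_(F i) x * g n x) +
      mean P (fun x => tail N x * g n x).
    rewrite -mean_sum => [|i]; last exact: b1g.
    rewrite -meanD; last 2 first.
    - by apply: bmeas_sum => i; exact: b1g.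
    - exact: bmeasM.
    by apply: eq_mean => x; rewrite /tail -mulr_suml; ring.
  have E2 : mean P \1_(\bigcup_i F i) =
      \sum_(i < N) mean P \1_(F i) + mean P (tail N).
    rewrite -mean_sum => [|i]; last exact: b1.
    rewrite -meanD//; last by apply: bmeas_sum => i; exact: b1.
    by apply: eq_mean => x; rewrite /tail; ring.
  have h3 : `|mean P (fun x => tail N x * g n x)| <= M * mean P (tail N).
    have btg : bmeas (fun x => tail N x * g n x) by exact: bmeasM.
    apply: le_trans (le_norm_mean _ btg) _; rewrite -meanZ//; apply: le_mean.
    - exact: bmeas_norm.
    - exact: bmeasZ.
    - by move=> x; rewrite normrM ger0_norm// mulrC ler_wpM2r.
  have h4 : (M + `|l| + 1) * mean P (tail N) <= e / 2.
    by rewrite mulrC -ler_pdivlMr// ltr_pwDr// addr_ge0.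
  have t0 : 0 <= mean P (tail N) by exact: mean_ge0.
  rewrite E1 E2 mulrDl mulr_suml.
  set s1 := \sum_(i < N) _ in hn *; set s2 := \sum_(i < N) _ in hn *.
  set u := mean P (tail N) in h3 h4 t0 *; set v := mean P _ in h3 *.
  have h5 : `|u * l| <= `|l| * u by rewrite normrM ger0_norm// mulrC.
  have -> : s1 + u * l - (s2 + v) = (s1 - s2) + (u * l - v) by ring.
  apply: le_trans (ler_normD _ _) _.
  have := ler_normB (u * l) v.
  by move: hn h3 h4 h5; nra.
Qed.

End independence_extension.

(** ** The doubling map and Walsh functions *)

Section doubling_map.
Context (R : realType).
Local Notation RR := (measurableTypeR R).
Implicit Types (f g : RR -> R) (x y : R).

Definition bit (x : RR) : R := if 2^-1 <= x then 1 else 0.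

Definition dbl (x : RR) : RR := 2 * x - bit x.

(** The Rademacher sign of the first binary digit. *)
Definition rad (x : RR) : R := 1 - 2 * bit x.

Lemma bmeas_bit : bmeas bit.
Proof.
split; last by exists 1 => x; rewrite /bit; case: ifP; rewrite ?normr1 ?normr0.
apply: measurable_fun_ifT => //.
exact: measurable_fun_ler.
Qed.

Lemma bmeas_rad : bmeas rad.
Proof.
by apply: bmeasB; [exact: bmeas_cst|apply: bmeasZ; exact: bmeas_bit].
Qed.

Lemma measurable_dbl : measurable_fun setT dbl.
Proof.
by apply: measurable_funB; [exact: measurable_funM|case: bmeas_bit].
Qed.

Lemma measurable_iter_dbl n : measurable_fun setT (iter n dbl).
Proof.
elim: n => [|n IH]; first exact: measurable_id.
by apply: (measurableT_comp measurable_dbl).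
Qed.

Lemma bmeas_dbl f n : bmeas f -> bmeas (fun x => f (iter n dbl x)).
Proof. by move=> bf; apply: bmeas_comp bf (measurable_iter_dbl n). Qed.

Lemma bit_half x : 0 <= x < 1 -> bit (x / 2) = 0.
Proof. by move=> x01; rewrite /bit ifF//; apply/negP; lra. Qed.

Lemma bit_half1 x : 0 <= x < 1 -> bit ((x + 1) / 2) = 1.
Proof. by move=> x01; rewrite /bit ifT//; lra. Qed.

Lemma dbl_half x : 0 <= x < 1 -> dbl (x / 2) = x.
Proof. by move=> x01; rewrite /dbl bit_half//; lra. Qed.

Lemma dbl_half1 x : 0 <= x < 1 -> dbl ((x + 1) / 2) = x.
Proof. by move=> x01; rewrite /dbl bit_half1//; lra. Qed.

Lemma dbl_itv x : 0 <= x < 1 -> 0 <= dbl x < 1.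
Proof. by rewrite /dbl /bit; case: ifP => h x01; lra. Qed.

Lemma rad_sqr x : rad x * rad x = 1.
Proof. by rewrite /rad /bit; case: ifP => _; lra. Qed.

Lemma rad_norm x : `|rad x| = 1.
Proof. 
rewrite /rad /bit; case: ifP => _; rewrite ?mulr1 ?mulr0 ?subr0 ?normr1//.
by rewrite (_ : 1 - 2 = -1) ?normrN1//; lra.
Qed.

(** [x / 2] and [(x + 1) / 2] are the two inverse branches of the doubling map. *)
Lemma mean_unif_branches f f0 f1 : bmeas f -> bmeas f0 -> bmeas f1 ->
    (forall x, 0 <= x < 1 -> f (x / 2) = f0 x) ->
    (forall x, 0 <= x < 1 -> f ((x + 1) / 2) = f1 x) ->
  mean (unif R) f = 2^-1 * (mean (unif R) f0 + mean (unif R) f1).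
Proof.
move=> bf bf0 bf1 e0 e1; rewrite mean_unif_halves//; congr (_ * (_ + _)).
  apply: eq_mean_unif => //.
  have -> : (fun x : RR => f (x / 2)) = (fun x => f (2^-1 * x + 0)).
    by apply/funext => x; congr f; lra.
  exact: bmeas_affine.
apply: eq_mean_unif => //.
have -> : (fun x : RR => f ((x + 1) / 2)) = (fun x => f (2^-1 * x + 2^-1)).
  by apply/funext => x; congr f; lra.
exact: bmeas_affine.
Qed.

Lemma mean_dbl f : bmeas f -> mean (unif R) (fun x => f (dbl x)) = mean (unif R) f.
Proof.
move=> bf; rewrite (@mean_unif_branches _ f f)//; first lra.
- exact: (bmeas_dbl 1 bf).
- by move=> x x01; rewrite dbl_half.
- by move=> x x01; rewrite dbl_half1.
Qed.

Lemma mean_iter_dbl n f : bmeas f ->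
  mean (unif R) (fun x => f (iter n dbl x)) = mean (unif R) f.
Proof.
elim: n f => [//|n IH] f bf; rewrite -(mean_dbl bf) -(IH _ (bmeas_dbl 1 bf)).
by apply: eq_mean => x /=.
Qed.

Lemma bmeas_rad_dbl f : bmeas f -> bmeas (fun x => rad x * f (dbl x)).
Proof. by move=> bf; apply: bmeasM; [exact: bmeas_rad|exact: (bmeas_dbl 1 bf)]. Qed.

Lemma mean_rad_dbl f : bmeas f -> mean (unif R) (fun x => rad x * f (dbl x)) = 0.
Proof.
move=> bf; have bfN := bmeasZ (-1) bf.
rewrite (mean_unif_branches (bmeas_rad_dbl bf) bf bfN).
- by rewrite meanZ//; lra.
- by move=> x x01; rewrite dbl_half// /rad bit_half//; lra.
- by move=> x x01; rewrite dbl_half1// /rad bit_half1//; lra.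
Qed.

(** The product of the signs of the digits [0] and [j + 1]: the translates of
these functions under the shift of digits are pairwise distinct Walsh
functions, hence orthogonal. *)
Definition walsh (j : nat) (x : RR) : R := rad x * rad (iter j.+1 dbl x).

Lemma bmeas_walsh j : bmeas (walsh j).
Proof.
by apply: bmeasM; [exact: bmeas_rad|exact: (bmeas_dbl j.+1 bmeas_rad)].
Qed.

Lemma walsh_norm j x : `|walsh j x| = 1.
Proof. by rewrite normrM !rad_norm mulr1. Qed.

Lemma walsh_sqr j x : walsh j x * walsh j x = 1.
Proof. by rewrite /walsh mulrACA !rad_sqr mulr1. Qed.

Lemma mean_walsh j : mean (unif R) (walsh j) = 0.
Proof.
rewrite -(mean_rad_dbl (bmeas_dbl j bmeas_rad)); apply: eq_mean => x.
by rewrite /walsh iterSr.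
Qed.

(** For [k > 0] only the factor [rad x] depends on the first digit. For [k = 0]
and [i < j] the first digits cancel, and after [i + 1] doublings the same
argument applies. *)
Lemma mean_walsh_shift i j k : i != j \/ (0 < k)%N ->
  mean (unif R) (fun x => walsh i (iter k dbl x) * walsh j x) = 0.
Proof.
case: k => [|k] h.
  have {h} : i != j by case: h.
  wlog ij : i j / (i < j)%N => [wl|_].
    rewrite neq_ltn => /orP[] ij; first by rewrite wl// ltn_eqF.
    rewrite -(wl j i ij); last by rewrite ltn_eqF.
    by apply: eq_mean => x; rewrite mulrC.
  pose g x := rad x * rad (iter (j - i.+1) dbl (dbl x)).
  have bg : bmeas g by exact: (bmeas_rad_dbl (bmeas_dbl _ bmeas_rad)).
  rewrite -(mean_rad_dbl (bmeas_dbl (j - i.+1) bmeas_rad)) -(mean_iter_dbl i.+1 bg).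
  apply: eq_mean => x /=; rewrite /walsh /g mulrACA rad_sqr mul1r.
  congr (_ * rad _).
  have -> : iter j.+1 dbl x = iter (j - i.+1) dbl (dbl (iter i.+1 dbl x)).
    by rewrite -iterSr -iterD addSn subnK.
  by [].
pose g x := walsh i (iter k dbl x) * rad (iter j dbl x).
have bg : bmeas g.
  by apply: bmeasM; [exact: (bmeas_dbl k (bmeas_walsh i))|exact: bmeas_dbl bmeas_rad].
rewrite -(mean_rad_dbl bg); apply: eq_mean => x.
by rewrite /g /walsh -!iterSr; ring.
Qed.

Lemma measurable_below (a : R) : measurable (`]-oo, a[%classic : set RR).
Proof. exact: measurable_itv. Qed.

Local Notation below a := (\1_(`]-oo, a[%classic : set RR) : RR -> R).

Lemma belowE a x : below a x = if x < a then 1 else 0.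
Proof.
rewrite indicE; case: ifPn => xa; last by rewrite memNset//= in_itv/=; exact/negP.
by rewrite mem_set//= in_itv.
Qed.

Lemma bmeas_below a : bmeas (below a).
Proof. by apply: bmeas_indic; exact: measurable_below. Qed.

Lemma mean_below_halves a : mean (unif R) (below a) =
  2^-1 * (mean (unif R) (below (2 * a)) + mean (unif R) (below (2 * a - 1))).
Proof.
apply: mean_unif_branches => [|||x _|x _]; [exact: bmeas_below..| |].
  by rewrite !belowE ltr_pdivrMr// mulrC.
by rewrite !belowE ltr_pdivrMr// ltrBrDr mulrC.
Qed.

(** One step of the doubling map replaces the ray below [a] by the rays below
[2 * a] and [2 * a - 1], of which one is trivial in the unit interval: the
error is halved. *)
Lemma dbl_mixing_below f (M : R) n a : bmeas f -> (forall x, `|f x| <= M) ->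
  `|mean (unif R) (fun x => below a x * f (iter n dbl x)) -
    mean (unif R) (below a) * mean (unif R) f| <= 2 * M / 2 ^+ n.
Proof.
move=> bf fM.
have M0 : 0 <= M by apply: le_trans (fM 0).
have meanM : `|mean (unif R) f| <= M.
  apply: le_trans (le_norm_mean _ bf) _; rewrite -[leRHS](mean_cst (unif R)).
  by apply: le_mean => //; [exact: bmeas_norm|exact: bmeas_cst].
have bb k c : bmeas (fun x => below c x * f (iter k dbl x)).
  by apply: bmeasM; [exact: bmeas_below|exact: bmeas_dbl].
have b01 c x : 0 <= below c x <= 1 by rewrite belowE; case: ifP; rewrite ?lexx ?ler01.
elim: n a => [|n IH] a.
  rewrite expr0 divr1 mulr_natl mulr2n; apply: le_trans (ler_normB _ _) _; apply: lerD.
    apply: (le_trans (le_norm_mean (unif R) (bb 0%N a))); rewrite -[leRHS](mean_cst (unif R)).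
    apply: le_mean; [exact/bmeas_norm/bb|exact: bmeas_cst|].
    move=> x; rewrite normrM -[leRHS]mul1r ler_pM//.
    by have := b01 a x; rewrite ler_norml; lra.
  rewrite normrM -[leRHS]mul1r ler_pM// ger0_norm; last first.
    by apply: mean_ge0 => x; case/andP: (b01 a x).
  rewrite -[leRHS](mean_cst (unif R)); apply: le_mean.
  - exact: bmeas_below.
  - exact: bmeas_cst.
  - by move=> x; case/andP: (b01 a x).
have E : mean (unif R) (fun x => below a x * f (iter n.+1 dbl x)) =
    2^-1 * (mean (unif R) (fun x => below (2 * a) x * f (iter n dbl x)) +
            mean (unif R) (fun x => below (2 * a - 1) x * f (iter n dbl x))).
  apply: mean_unif_branches => [|||x x01|x x01]; [exact: bb..| |].
    by rewrite iterSr dbl_half// !belowE ltr_pdivrMr// (mulrC a).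
  by rewrite iterSr dbl_half1// !belowE ltr_pdivrMr// ltrBrDr (mulrC a).
have {}E : mean (unif R) (fun x => below a x * f (iter n.+1 dbl x)) -
    mean (unif R) (below a) * mean (unif R) f =
    2^-1 * (mean (unif R) (fun x => below (2 * a) x * f (iter n dbl x)) -
            mean (unif R) (below (2 * a)) * mean (unif R) f) +
    2^-1 * (mean (unif R) (fun x => below (2 * a - 1) x * f (iter n dbl x)) -
            mean (unif R) (below (2 * a - 1)) * mean (unif R) f).
  by rewrite E (mean_below_halves a); lra.
have z0 c : c <= 0 -> mean (unif R) (fun x => below c x * f (iter n dbl x)) -
            mean (unif R) (below c) * mean (unif R) f = 0.
  move=> c0; have bz := bmeas_cst RR (0 : R).
  rewrite (eq_mean_unif (bb n c) bz) => [|x x01].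
    rewrite (eq_mean_unif (bmeas_below c) bz) => [|x x01].
      by rewrite mean_cst mul0r subrr.
    by rewrite belowE ifF//; apply/negP; lra.
  by rewrite belowE ifF ?mul0r//; apply/negP; lra.
have z1 c : 1 <= c -> mean (unif R) (fun x => below c x * f (iter n dbl x)) -
            mean (unif R) (below c) * mean (unif R) f = 0.
  move=> c1; rewrite (eq_mean_unif (bb n c) (bmeas_dbl n bf)) => [|x x01].
    rewrite (eq_mean_unif (bmeas_below c) (bmeas_cst RR (1 : R))) => [|x x01].
      by rewrite mean_cst mul1r mean_iter_dbl// subrr.
    by rewrite belowE ifT//; lra.
  by rewrite belowE ifT ?mul1r//; lra.
have X k : 2^-1 * (2 * M / 2 ^+ k) = 2 * M / 2 ^+ k.+1.
  by rewrite exprS; field; rewrite expf_neq0.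
have nh (u : R) : `|2^-1 * u| = 2^-1 * `|u|.
  by rewrite normrM (@ger0_norm _ 2^-1).
rewrite E -X; case: (leP a 2^-1) => ha.
  rewrite (z0 (2 * a - 1)); last lra.
  by rewrite mulr0 addr0 nh ler_wpM2l//; exact: IH.
rewrite (z1 (2 * a)); last lra.
by rewrite mulr0 add0r nh ler_wpM2l//; exact: IH.
Qed.

Lemma dbl_mixing f (B : set RR) : bmeas f -> measurable B ->
  (fun n => mean (unif R) (fun x => \1_B x * f (iter n dbl x))) @ \oo -->
    mean (unif R) \1_B * mean (unif R) f.
Proof.
move=> bf mB; have [M M0 fM] := bmeas_ge0 bf.
apply: (@independence_extension _ RR R (unif R) (@RGenInftyO.G R) _ _ M) => //.
- exact: RGenInftyO.measurableE.
- move=> _ _ [a ->] [b ->]; exists (Num.min a b).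
  by apply/seteqP; split => x /=; rewrite !in_itv/= lt_min; [move=> [-> ->]|move/andP].
- by move=> n; exact: bmeas_dbl.
- under eq_fun do rewrite mean_iter_dbl//; exact: cvg_cst.
- move=> _ [a ->]; apply/cvgrPdist_le => /= e e0.
  have e1 : 0 < e / (2 * M + 1) by rewrite divr_gt0// ltr_wpDl// mulr_ge0.
  have : (fun n => 2^-1 ^+ n : R) @ \oo --> (0 : R).
    by apply: cvg_expr; rewrite ger0_norm//; lra.
  move=> /cvgrPdist_le /(_ _ e1); apply: filterS => n.
  rewrite sub0r normrN ger0_norm ?exprn_ge0// => hn.
  rewrite distrC; apply: le_trans (dbl_mixing_below n a bf fM) _.
  rewrite -exprVn; apply: (@le_trans _ _ ((2 * M + 1) * 2^-1 ^+ n)).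
    by rewrite ler_wpM2r ?exprn_ge0//; lra.
  by rewrite mulrC -ler_pdivlMr// ltr_wpDl// mulr_ge0.
Qed.

End doubling_map.

(** ** The baker map *)

Section baker_map.
Context (R : realType).
Local Notation RR := (measurableTypeR R).
Local Notation X := (RR * RR)%type.
Implicit Types (g : X -> R) (p : X).

Definition square : probability X R := (unif R \x unif R)%E.

Definition in_square p := (0 <= p.1 < 1) && (0 <= p.2 < 1).

(** Seen in binary, the first digit of the abscissa becomes the first digit of the
ordinate: a two-sided shift of digits. Outside of the unit square, on a null
set, the map is the identity, so that it is a bijection of the plane. *)
Definition baker p : X :=
  if in_square p then (dbl p.1, (p.2 + bit p.1) / 2) else p.

Definition unbaker p : X :=
  if in_square p then ((p.1 + bit p.2) / 2, dbl p.2) else p.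

Lemma in_square_baker p : in_square p -> in_square (baker p).
Proof.
move=> Qp; rewrite /baker Qp; move: Qp; case: p => x y /andP[/= x01 y01].
rewrite /in_square/= dbl_itv//=; rewrite /bit; case: ifP => _; lra.
Qed.

Lemma in_square_unbaker p : in_square p -> in_square (unbaker p).
Proof.
move=> Qp; rewrite /unbaker Qp; move: Qp; case: p => x y /andP[/= x01 y01].
rewrite /in_square/= dbl_itv//= andbT; rewrite /bit; case: ifP => _; lra.
Qed.

Lemma half_bit_dbl (x : RR) : (dbl x + bit x) / 2 = x.
Proof. by rewrite /dbl; lra. Qed.

Lemma bit_branch (x y : RR) : 0 <= y < 1 -> bit ((y + bit x) / 2) = bit x.
Proof.
move=> y01; rewrite {2 3}/bit; case: ifP => _; first exact: bit_half1.
by rewrite addr0 bit_half.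
Qed.

Lemma dbl_branch (x y : RR) : 0 <= y < 1 -> dbl ((y + bit x) / 2) = y.
Proof. by move=> y01; rewrite /dbl bit_branch//; lra. Qed.

Lemma bakerK : cancel baker unbaker.
Proof.
move=> p; have [Qp|nQp] := boolP (in_square p); last first.
  by rewrite /baker (negbTE nQp) /unbaker (negbTE nQp).
rewrite /unbaker in_square_baker// /baker Qp/=.
case: p Qp => x y /andP[/= x01 y01].
by rewrite bit_branch// dbl_branch// half_bit_dbl.
Qed.

Lemma unbakerK : cancel unbaker baker.
Proof.
move=> p; have [Qp|nQp] := boolP (in_square p); last first.
  by rewrite /unbaker (negbTE nQp) /baker (negbTE nQp).
rewrite /baker in_square_unbaker// /unbaker Qp/=.
case: p Qp => x y /andP[/= x01 y01].
by rewrite bit_branch// dbl_branch// half_bit_dbl.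
Qed.

Lemma measurable_in_square : measurable_fun setT in_square.
Proof.
have m1 : measurable_fun setT (fst : X -> RR) by exact: measurable_fst.
have m2 : measurable_fun setT (snd : X -> RR) by exact: measurable_snd.
rewrite /in_square; apply: (@measurable_and _ _ _ (fun p : X => 0 <= p.1 < 1)
  (fun p : X => 0 <= p.2 < 1)).
  apply: (@measurable_and _ _ _ (fun p : X => 0 <= p.1) (fun p : X => p.1 < 1)).
    exact: measurable_fun_ler.
  exact: measurable_fun_ltr.
apply: (@measurable_and _ _ _ (fun p : X => 0 <= p.2) (fun p : X => p.2 < 1)).
  exact: measurable_fun_ler.
exact: measurable_fun_ltr.
Qed.

Lemma measurable_half_bit (u v : X -> RR) : measurable_fun setT u ->
  measurable_fun setT v -> measurable_fun setT (fun p => (u p + bit (v p)) / 2 : RR).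
Proof.
move=> mu mv; apply: measurable_funM => //; apply: measurable_funD => //.
by apply: measurableT_comp => //; case: (bmeas_bit R).
Qed.

Lemma measurable_baker : measurable_fun setT baker.
Proof.
apply: measurable_fun_ifT; [exact: measurable_in_square| |exact: measurable_id].
apply: measurable_fun_pair.
  exact: (measurableT_comp (@measurable_dbl R) measurable_fst).
exact: (measurable_half_bit measurable_snd measurable_fst).
Qed.

Lemma measurable_unbaker : measurable_fun setT unbaker.
Proof.
apply: measurable_fun_ifT; [exact: measurable_in_square| |exact: measurable_id].
apply: measurable_fun_pair.
  exact: (measurable_half_bit measurable_fst measurable_snd).
exact: (measurableT_comp (@measurable_dbl R) measurable_snd).
Qed.

Lemma eq_mean_square f g : bmeas f -> bmeas g ->
  (forall p, in_square p -> f p = g p) -> mean square f = mean square g.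
Proof.
move=> bf bg fg; rewrite !mean_prod//; apply: eq_mean_unif.
- exact: (bmeas_mean1 (unif R) (unif R) bf).
- exact: (bmeas_mean1 (unif R) (unif R) bg).
- move=> x x01; apply: eq_mean_unif; [exact: bmeas_pair1..|].
  by move=> y y01; apply: fg; rewrite /in_square/= x01 y01.
Qed.

(** On both halves of the square the abscissa is stretched and the ordinate
contracted by [2]; [mean_unif_halves] undoes the first change in the abscissa
and the second one in the ordinate. *)
Lemma mpres_baker : mpres square square baker.
Proof.
split; first exact: measurable_baker.
move=> g bg.
have bg0 : bmeas (fun p => g (baker p)) by apply: bmeas_comp bg measurable_baker.
have mhalf (c : R) : measurable_fun setT ((fun p => (p.1, (p.2 + c) / 2)) : X -> X).
  apply/measurable_fun_pairP; split; first exact: measurable_fst.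
  apply: (@measurable_funM _ _ _ _ (fun p : X => p.2 + c) (cst 2^-1)) => //.
  by apply: measurable_funD.
have bgc (c : R) : bmeas (fun p : X => g (p.1, (p.2 + c) / 2)).
  by apply: (bmeas_comp bg (mhalf c)).
rewrite mean_prod// (mean_prod (unif R) (unif R) bg).
rewrite [LHS](@mean_unif_branches R _
  (fun x => mean (unif R) (fun y => g (x, (y + 0) / 2)))
  (fun x => mean (unif R) (fun y => g (x, (y + 1) / 2)))); last 5 first.
- exact: (bmeas_mean1 (unif R) (unif R) bg0).
- exact: (bmeas_mean1 (unif R) (unif R) (bgc 0)).
- exact: (bmeas_mean1 (unif R) (unif R) (bgc 1)).
- move=> x x01; apply: eq_mean_unif.
  + exact: (bmeas_pair1 (x / 2) bg0).
  + exact: (bmeas_pair1 x (bgc 0)).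
  + move=> y y01; rewrite /baker /in_square/= bit_half// dbl_half//.
    by rewrite ifT// y01 andbT; lra.
- move=> x x01; apply: eq_mean_unif.
  + exact: (bmeas_pair1 ((x + 1) / 2) bg0).
  + exact: (bmeas_pair1 x (bgc 1)).
  + move=> y y01; rewrite /baker /in_square/= bit_half1// dbl_half1//.
    by rewrite ifT// y01 andbT; lra.
rewrite -meanD; last 2 first.
- exact: (bmeas_mean1 (unif R) (unif R) (bgc 0)).
- exact: (bmeas_mean1 (unif R) (unif R) (bgc 1)).
rewrite -meanZ; last first.
  apply: bmeasD; first exact: (bmeas_mean1 (unif R) (unif R) (bgc 0)).
  exact: (bmeas_mean1 (unif R) (unif R) (bgc 1)).
apply: eq_mean => x; rewrite [RHS]mean_unif_halves; last exact: bmeas_pair1.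
by under eq_mean do rewrite addr0.
Qed.

Lemma mpres_unbaker : mpres square square unbaker.
Proof.
split; first exact: measurable_unbaker.
move=> g bg; rewrite -(mpres_baker.2 _ (bmeas_comp bg measurable_unbaker)).
by apply: eq_mean => p; rewrite bakerK.
Qed.

End baker_map.

(** ** Invariant sets of the baker map *)

Section dyadic_rays.
Context (R : realType).
Local Notation RR := (measurableTypeR R).

Definition dyadic_rays : set (set RR) :=
  [set A | exists (n : nat) (k : int), A = `]-oo, k%:~R / 2 ^+ n[%classic].

Lemma dyadic_rays_setI : setI_closed dyadic_rays.
Proof.
move=> _ _ [m [k ->]] [n [l ->]].
have [kl|lk] := leP (k%:~R / 2 ^+ m : R) (l%:~R / 2 ^+ n).
  exists m, k; apply/seteqP; split => x /=; rewrite !in_itv/=; first by case.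
  by move=> xk; split => //; exact: lt_le_trans kl.
exists n, l; apply/seteqP; split => x /=; rewrite !in_itv/=; first by case.
by move=> xl; split => //; exact: lt_trans lk.
Qed.

(** A ray is the union of the rays below the dyadic lower approximations of its
end point. *)
Lemma dyadic_rays_generate : (measurable : set (set RR)) = <<s dyadic_rays >>.
Proof.
apply/seteqP; split; last first.
  apply: smallest_sub; first exact: sigma_algebra_measurable.
  by move=> _ [n [k ->]]; exact: measurable_itv.
have -> : (measurable : set (set RR)) = <<s @RGenInftyO.G R >>.
  exact: RGenInftyO.measurableE.
apply: smallest_sub; first exact: smallest_sigma_algebra.
move=> _ [a ->].
have -> : `]-oo, a[%classic =
    \bigcup_n `]-oo, (Num.floor (2 ^+ n * a))%:~R / 2 ^+ n[%classic.
  apply/seteqP; split => x /=; rewrite ?in_itv/=; last first.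
    move=> [n _ /=]; rewrite in_itv/= => xn; apply: lt_le_trans xn _.
    by rewrite ler_pdivrMr ?exprn_gt0// mulrC floor_le.
  move=> xa.
  have : (fun n => 2^-1 ^+ n : R) @ \oo --> (0 : R).
    by apply: cvg_expr; rewrite ger0_norm//; lra.
  have ax : 0 < a - x by lra.
  move=> /cvgrPdist_lt /(_ _ ax)[n _ /(_ n (leqnn n))].
  rewrite sub0r normrN ger0_norm ?exprn_ge0// exprVn => hn.
  exists n => //=; rewrite in_itv/= ltr_pdivlMr ?exprn_gt0//.
  have p0 : 0 < 2 ^+ n :> R by rewrite exprn_gt0.
  have := floor_itv (2 ^+ n * a); rewrite intrD => /andP[_ fl].
  have : 2 ^+ n * (2 ^+ n)^-1 < 2 ^+ n * (a - x) by rewrite ltr_pM2l.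
  rewrite mulfV ?gt_eqF//; lra.
apply: sigma_algebra_bigcup => n; apply: sub_sigma_algebra.
by exists n, (Num.floor (2 ^+ n * a)).
Qed.

End dyadic_rays.

Section rectangles.
Context d1 d2 (T1 : measurableType d1) (T2 : measurableType d2) (R : realType).
Context (P1 : probability T1 R) (P2 : probability T2 R).

Definition rectangles : set (set (T1 * T2)) :=
  [set A `*` B | A in measurable & B in measurable].

Lemma rectangles_setI : setI_closed rectangles.
Proof.
move=> _ _ [A mA [B mB <-]] [C mC [D mD <-]].
exists (A `&` C); first exact: measurableI.
by exists (B `&` D); [exact: measurableI|rewrite setXI].
Qed.

Lemma rectangles_generate : (measurable : set (set (T1 * T2))) = <<s rectangles >>.
Proof. exact: measurable_prod_measurableType. Qed.

Lemma indic_setX (A : set T1) (B : set T2) p :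
  \1_(A `*` B) p = \1_A p.1 * \1_B p.2 :> R.
Proof. by rewrite !indicE in_setX; case: (_ \in _); rewrite ?mul1r ?mul0r. Qed.

Lemma mean_prod_mul (f : T1 -> R) (g : T2 -> R) : bmeas f -> bmeas g ->
  mean (P1 \x P2)%E (fun p => f p.1 * g p.2) = mean P1 f * mean P2 g.
Proof.
move=> bf bg; rewrite mean_prod; last first.
  apply: bmeasM; first by apply: (bmeas_comp bf); exact: measurable_fst.
  by apply: (bmeas_comp bg); exact: measurable_snd.
rewrite mulrC -meanZ//; apply: eq_mean => x; rewrite /= meanZ//; exact: mulrC.
Qed.

End rectangles.

Section baker_ergodic.
Context (R : realType).
Local Notation RR := (measurableTypeR R).
Local Notation X := (RR * RR)%type.
Local Notation P2 := (square R).
Local Notation below a := (\1_(`]-oo, a[%classic : set RR) : RR -> R).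
Context (A : set X).
Hypothesis mA : measurable A.
Hypothesis invA : forall p, A (baker p) <-> A p.

Let one (p : X) : R := \1_A p.
Let theta := mean P2 one.

Let bone : bmeas one. Proof. exact: bmeas_indic. Qed.

Let one_baker p : one (baker p) = one p.
Proof.
rewrite /one !indicE; congr (_%:R); congr nat_of_bool.
by apply/idP/idP; rewrite !inE => /invA.
Qed.

Let bfst (e : RR -> R) : bmeas e -> bmeas (fun p : X => e p.1).
Proof. by move=> be; apply: (bmeas_comp be); exact: measurable_fst. Qed.

Let bsnd (e : RR -> R) : bmeas e -> bmeas (fun p : X => e p.2).
Proof. by move=> be; apply: (bmeas_comp be); exact: measurable_snd. Qed.

Let mean_one_baker (g : X -> R) : bmeas g ->
  mean P2 (fun p => one p * g (baker p)) = mean P2 (fun p => one p * g p).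
Proof.
move=> bg; have bog : bmeas (fun p => one p * g p) by exact: bmeasM.
rewrite -((mpres_baker R).2 _ bog).
by apply: eq_mean => p; rewrite one_baker.
Qed.

Let mean_one_fst_dbl (e : RR -> R) n : bmeas e ->
  mean P2 (fun p => one p * e (iter n (@dbl R) p.1)) =
  mean P2 (fun p => one p * e p.1).
Proof.
elim: n e => [//|n IH] e be.
rewrite -[RHS](IH _ be) -[RHS](mean_one_baker (bfst (bmeas_dbl n be))).
apply: eq_mean_square.
- by apply: bmeasM => //; exact: (bfst (bmeas_dbl n.+1 be)).
- apply: bmeasM => //.
  apply: (bmeas_comp (bfst (bmeas_dbl n be))); exact: measurable_baker.
- by move=> p Qp; rewrite /baker Qp/= -iterSr.
Qed.

(* The mean on the left does not change when [e] is composed with the doubling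
   map, whose mixing makes [A] independent of the abscissa. *)
Let mean_one_fst (e : RR -> R) : bmeas e ->
  mean P2 (fun p => one p * e p.1) = theta * mean (unif R) e.
Proof.
move=> be; have [M M0 eM] := bmeas_ge0 be.
have : (fun n => mean P2 (fun p => \1_A p * e (iter n (@dbl R) p.1))) @ \oo -->
    mean P2 \1_A * mean (unif R) e.
  apply: (@independence_extension _ X R P2 (@rectangles _ _ RR RR)
    (fun n p => e (iter n (@dbl R) p.1)) _ M) => //.
  - exact: rectangles_generate.
  - exact: rectangles_setI.
  - by move=> n; exact: (bfst (bmeas_dbl n be)).
  - rewrite (_ : (fun n => _) = (fun=> mean (unif R) e)); first exact: cvg_cst.
    apply/funext => n; rewrite -(mean_iter_dbl n be).
    have := mean_prod_mul (unif R) (unif R) (bmeas_dbl n be) (bmeas_cst RR (1 : R)).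
    by rewrite mean_cst mulr1 => <-; apply: eq_mean => p; rewrite mulr1.
  - move=> _ [J mJ [K mK <-]].
    have b1J : bmeas (\1_J : RR -> R) by exact: bmeas_indic.
    have b1K : bmeas (\1_K : RR -> R) by exact: bmeas_indic.
    have -> : mean P2 \1_(J `*` K) = mean (unif R) \1_J * mean (unif R) \1_K.
      rewrite -mean_prod_mul//; apply: eq_mean => p; exact: indic_setX.
    rewrite (_ : (fun n => _) = (fun n => mean (unif R) (fun x =>
        \1_J x * e (iter n (@dbl R) x)) * mean (unif R) \1_K)).
      rewrite mulrAC; by apply: cvgM; [exact: dbl_mixing|exact: cvg_cst].
    apply/funext => n; rewrite -mean_prod_mul//; last first.
      by apply: bmeasM => //; exact: bmeas_dbl.
    by apply: eq_mean => p; rewrite indic_setX; ring.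
rewrite (_ : (fun n => _) = (fun=> mean P2 (fun p => one p * e p.1))).
  by move=> h; apply: (@cvg_unique _ (@Rhausdorff R) _ _ _ _ (cvg_cst _) h).
by apply/funext => n; exact: mean_one_fst_dbl.
Qed.

(* One step of the baker map turns a condition on the first digit of the ordinate
   into one on the first digit of the abscissa, which is absorbed in [e]. *)
Let mean_one_dyadic n (k : int) (e : RR -> R) : bmeas e ->
  mean P2 (fun p => one p * (e p.1 * below (k%:~R / 2 ^+ n) p.2)) =
  theta * mean (unif R) e * mean (unif R) (below (k%:~R / 2 ^+ n)).
Proof.
elim: n k e => [|n IH] k e be.
  rewrite expr0 divr1; have bk := @bmeas_below R k%:~R.
  have bL : bmeas (fun p => one p * (e p.1 * below k%:~R p.2)).
    by apply: bmeasM => //; apply: bmeasM; [exact: bfst|exact: bsnd].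
  have [k1|k0] := leP 1 k.
    have k1R : 1 <= k%:~R :> R by rewrite -[1]/(1%:~R) ler_int.
    rewrite (eq_mean_square bL (bmeasM bone (bfst be))) => [|p /andP[_ p01]].
      rewrite mean_one_fst// (eq_mean_unif bk (bmeas_cst RR (1 : R))).
        by rewrite mean_cst mulr1.
      by move=> y y01; rewrite belowE ifT//; lra.
    by rewrite belowE ifT ?mulr1//; lra.
  have k0R : k%:~R <= 0 :> R by rewrite -[0]/(0%:~R) ler_int -ltzD1.
  rewrite (eq_mean_square bL (bmeas_cst X (0 : R))) => [|p /andP[_ p01]].
    rewrite (eq_mean_unif bk (bmeas_cst RR (0 : R))) ?mean_cst ?mulr0//.
    by move=> y y01; rewrite belowE ifF//; apply/negP; lra.
  by rewrite belowE ifF ?mulr0//; apply/negP; lra.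
set a := k%:~R / 2 ^+ n.+1.
have p0 : 2 ^+ n != 0 :> R by rewrite expf_neq0.
have a2 : 2 * a = k%:~R / 2 ^+ n by rewrite /a exprS; field.
have a21 : 2 * a - 1 = (k - (2 ^ n)%N%:Z)%:~R / 2 ^+ n.
  by rewrite a2 intrB -pmulrn natrX mulrBl mulfV.
pose e0 (x : RR) := (1 - bit x) * e (dbl x).
pose e1 (x : RR) := bit x * e (dbl x).
have bed : bmeas (fun x : RR => e (dbl x)) by exact: (bmeas_dbl 1 be).
have be0 : bmeas e0.
  by apply: bmeasM => //; apply: bmeasB; [exact: bmeas_cst|exact: bmeas_bit].
have be1 : bmeas e1 by apply: bmeasM => //; exact: bmeas_bit.
have bg : bmeas (fun p : X => e p.1 * below a p.2).
  by apply: bmeasM; [exact: bfst|apply: bsnd; exact: bmeas_below].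
have bh (f : RR -> R) c : bmeas f ->
    bmeas (fun p : X => one p * (f p.1 * below c p.2)).
  move=> bf; apply: bmeasM => //.
  by apply: bmeasM; [exact: bfst|apply: bsnd; exact: bmeas_below].
have half_mean0 : mean (unif R) e0 = 2^-1 * mean (unif R) e.
  rewrite (mean_unif_branches be0 be (bmeas_cst RR (0 : R))).
  - by rewrite mean_cst addr0.
  - by move=> x x01; rewrite /e0 bit_half// dbl_half// subr0 mul1r.
  - by move=> x x01; rewrite /e0 bit_half1// subrr mul0r.
have half_mean1 : mean (unif R) e1 = 2^-1 * mean (unif R) e.
  rewrite (mean_unif_branches be1 (bmeas_cst RR (0 : R)) be).
  - by rewrite mean_cst add0r.
  - by move=> x x01; rewrite /e1 bit_half// mul0r.
  - by move=> x x01; rewrite /e1 bit_half1// dbl_half1// mul1r.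
rewrite -(mean_one_baker bg).
rewrite (@eq_mean_square _ _ (fun p => one p * (e0 p.1 * below (2 * a) p.2) +
    one p * (e1 p.1 * below (2 * a - 1) p.2))); last 3 first.
- by apply: bmeasM => //; apply: (bmeas_comp bg); exact: measurable_baker.
- by apply: bmeasD; exact: bh.
- move=> p Qp; rewrite /baker Qp/= /e0 /e1 !belowE ltr_pdivrMr// /bit.
  rewrite ltrBrDr (mulrC a); case: (2^-1 <= p.1) => /=.
    by rewrite subrr !mul0r mulr0 add0r mul1r.
  by rewrite addr0 subr0 mul1r !mul0r mulr0 addr0.
rewrite meanD; [|exact: bh..].
rewrite (mean_below_halves a) a21 a2 !IH// half_mean0 half_mean1.
ring.
Qed.

Let mean_one_snd (K : set RR) (e : RR -> R) : measurable K -> bmeas e ->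
  mean P2 (fun p => one p * (e p.1 * \1_K p.2)) =
  theta * mean (unif R) e * mean (unif R) \1_K.
Proof.
move=> mK be; have [M M0 eM] := bmeas_ge0 be.
pose gE (y : RR) := mean (unif R) (fun x => one (x, y) * e x).
have boe : bmeas (fun p : X => one p * e p.1) by apply: bmeasM => //; exact: bfst.
have bgE : bmeas gE := bmeas_mean2 (unif R) (unif R) boe.
have [C C0 gC] := bmeas_ge0 bgE.
have swap (L : set RR) : measurable L ->
    mean P2 (fun p => one p * (e p.1 * \1_L p.2)) =
    mean (unif R) (fun y => \1_L y * gE y).
  move=> mL; have bL : bmeas (\1_L : RR -> R) by exact: bmeas_indic.
  rewrite mean_prodC; last first.
    by apply: bmeasM => //; apply: bmeasM; [exact: bfst|exact: bsnd].
  apply: eq_mean => y; rewrite -meanZ; last exact: (bmeas_pair2 y boe).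
  by apply: eq_mean => x /=; ring.
have : (fun n : nat => mean (unif R) (fun y => \1_K y * gE y)) @ \oo -->
    mean (unif R) \1_K * (theta * mean (unif R) e).
  apply: (@independence_extension _ RR R (unif R) (@dyadic_rays R)
    (fun _ => gE) _ C) => //.
  - exact: dyadic_rays_generate.
  - exact: dyadic_rays_setI.
  - rewrite (_ : mean (unif R) gE = theta * mean (unif R) e); first exact: cvg_cst.
    by rewrite -mean_one_fst// mean_prodC.
  - move=> _ [n [k ->]]; rewrite -swap; last exact: measurable_below.
    by rewrite mean_one_dyadic// mulrC; exact: cvg_cst.
rewrite swap// mulrC => h.
exact: (@cvg_unique _ (@Rhausdorff R) _ _ _ _ (cvg_cst _) h).
Qed.

(** An invariant set is independent of every rectangle, hence of itself. *)
Lemma baker_ergodic : P2 A = 0%E \/ P2 A = 1%E.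
Proof.
have h : mean P2 (fun p => one p * one p) = theta * theta.
  have one1 p : `|one p| <= 1.
    by rewrite /one indicE; case: (_ \in _); rewrite ?normr1 ?normr0.
  have : (fun n : nat => mean P2 (fun p => \1_A p * one p)) @ \oo -->
      mean P2 \1_A * theta.
    apply: (@independence_extension _ X R P2 (@rectangles _ _ RR RR)
      (fun _ => one) _ 1) => //.
    - exact: rectangles_generate.
    - exact: rectangles_setI.
    - exact: cvg_cst.
    - move=> _ [J mJ [K mK <-]].
      have b1J : bmeas (\1_J : RR -> R) by exact: bmeas_indic.
      have b1K : bmeas (\1_K : RR -> R) by exact: bmeas_indic.
      have -> : mean P2 \1_(J `*` K) = mean (unif R) \1_J * mean (unif R) \1_K.
        by rewrite -mean_prod_mul//; apply: eq_mean => p; exact: indic_setX.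
      rewrite mulrC mulrA -mean_one_snd//.
      rewrite (_ : mean P2 (fun p => \1_(J `*` K) p * one p) =
        mean P2 (fun p => one p * (\1_J p.1 * \1_K p.2))); first exact: cvg_cst.
      by apply: eq_mean => p; rewrite indic_setX mulrC.
  by move=> h; apply: (@cvg_unique _ (@Rhausdorff R) _ _ _ _ (cvg_cst _) h).
have : theta * theta = theta.
  by rewrite -h; apply: eq_mean => p; rewrite /one indicE; case: (_ \in _);
    rewrite ?mulr1 ?mulr0.
have <- : theta%:E = P2 A by exact: mean_indic.
move=> /eqP; rewrite -subr_eq0 -[X in _ - X]mulr1 -mulrBr mulf_eq0 subr_eq0.
by case/orP => /eqP ->; [left|right].
Qed.

End baker_ergodic.

(** * The suspension of the baker map *)

Section integer_iteration.
Context (T : Type) (f g : T -> T).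
Hypothesis fK : cancel f g.
Hypothesis gK : cancel g f.

Definition ziter (k : int) (x : T) : T :=
  match k with Posz n => iter n f x | Negz n => iter n.+1 g x end.

Lemma ziterS k x : ziter (k + 1) x = f (ziter k x).
Proof.
case: k => [n|[|n]].
- by have -> : Posz n + 1 = Posz n.+1 by lia.
- by rewrite /= gK.
- have -> : Negz n.+1 + 1 = Negz n by lia.
  by rewrite /= gK.
Qed.

Lemma ziterP k x : ziter (k - 1) x = g (ziter k x).
Proof. by rewrite -[in RHS](subrK 1 k) ziterS fK. Qed.

Lemma ziterD k l x : ziter (k + l) x = ziter k (ziter l x).
Proof.
elim: k => [|n IH|n IH]; first by rewrite add0r.
  by rewrite -addn1 PoszD addrAC !ziterS IH.
have -> : - (n.+1)%:Z = - n%:Z - 1 by lia.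
by rewrite addrAC !ziterP IH.
Qed.

End integer_iteration.

Section suspension.
Context (R : realType).
Local Notation RR := (measurableTypeR R).
Local Notation X := (RR * RR)%type.
Local Notation T := (X * RR)%type.
Local Notation P2 := (square R).

Definition cube : probability T R := (P2 \x unif R)%E.

Definition height (y t : R) : int := Num.floor (y + t) - Num.floor y.

(** The third coordinate grows at unit speed, and the baker map is applied each
time it crosses an integer. It is brought back to its own integer cell, and not
to [[0, 1)], so that the formula defines a bijection of the whole space. *)
Definition susp (t : R) (z : T) : T :=
  (ziter (@baker R) (@unbaker R) (height z.2 t) z.1,
   (Num.floor z.2)%:~R + fpart (z.2 + t)).

Lemma floor_int_fpart (k : int) (u : R) : Num.floor (k%:~R + fpart u) = k.
Proof.
by apply: floor_def; have := fpart_itv u; rewrite intrD; lra.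
Qed.

Lemma susp0 z : susp 0 z = z.
Proof.
case: z => p y; rewrite /susp /height/= addr0 subrr/=; congr pair.
by rewrite /fpart; lra.
Qed.

Lemma suspD s t z : susp (s + t) z = susp s (susp t z).
Proof.
case: z => p y; rewrite /susp/= /height.
rewrite floor_int_fpart.
have E : (Num.floor y)%:~R + fpart (y + t) + s =
    y + (s + t) + (Num.floor y - Num.floor (y + t))%:~R :> R.
  by rewrite /fpart intrB; lra.
have F : Num.floor ((Num.floor y)%:~R + fpart (y + t) + s) =
    Num.floor (y + (s + t)) + (Num.floor y - Num.floor (y + t)).
  by rewrite E floorDrz ?intrKfloor// intr_int.
congr pair.
  rewrite -ziterD; [|exact: bakerK|exact: unbakerK].
  by congr (ziter _ _ _ p); rewrite F; lia.
congr (_ + _); rewrite [in RHS]/fpart F E /fpart.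
move: (Num.floor y - _) (Num.floor _) => l k; rewrite [(k + l)%:~R]intrD; lra.
Qed.

Lemma measurable_ziter_baker k :
  measurable_fun setT (ziter (@baker R) (@unbaker R) k).
Proof.
have miter (f : X -> X) n : measurable_fun setT f -> measurable_fun setT (iter n f).
  move=> mf; elim: n => [|n IH]; first exact: measurable_id.
  exact: (measurableT_comp mf IH).
case: k => n; first exact: (miter _ n (@measurable_baker R)).
exact: (miter _ n.+1 (@measurable_unbaker R)).
Qed.

Lemma measurable_susp2 :
  measurable_fun [set: T * RR] (fun q => susp q.2 q.1).
Proof.
have m1 : measurable_fun setT (fun q : T * RR => q.1.2).
  exact: (measurableT_comp measurable_snd measurable_fst).
have m2 : measurable_fun setT (fun q : T * RR => q.1.2 + q.2 : RR).
  by apply: measurable_funD => //; exact: measurable_snd.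
have mp : measurable_fun setT (fun q : T * RR => q.1.1).
  exact: (measurableT_comp measurable_fst measurable_fst).
apply: measurable_fun_pair.
  apply: (@measurable_fun_int _ _ _ _ (fun q : T * RR => height q.1.2 q.2)
    (fun k (q : T * RR) => ziter (@baker R) (@unbaker R) k q.1.1)) => k.
    rewrite (_ : _ @^-1` _ = \bigcup_l
      ((fun q : T * RR => Num.floor q.1.2) @^-1` [set l] `&`
       (fun q : T * RR => Num.floor (q.1.2 + q.2)) @^-1` [set k + l])).
      apply: countable_bigcupT_measurable => [|l]; first exact: countableP.
      by apply: measurableI; exact: measurable_floor_preimage.
    apply/seteqP; split => q /=.
      move=> <-; exists (Num.floor q.1.2) => //; split => //.
      by rewrite /height subrK.
    by move=> [l _ [/= <- e]]; rewrite /height e addrK.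
  exact: (measurableT_comp (measurable_ziter_baker k) mp).
apply: measurable_funD.
  apply: (@measurable_fun_int _ _ _ _ (fun q : T * RR => Num.floor q.1.2)
    (fun k (q : T * RR) => k%:~R : RR)) => k; last by [].
  exact: measurable_floor_preimage.
exact: (measurableT_comp (@measurable_fpart R) m2).
Qed.

Lemma measurable_susp t : measurable_fun setT (susp t).
Proof.
have m : measurable_fun setT (fun z : T => (z, t : RR)) by exact: measurable_fun_pair.
exact: (measurableT_comp measurable_susp2 m).
Qed.

Lemma mpres_ziter k : mpres P2 P2 (ziter (@baker R) (@unbaker R) k).
Proof.
split; first exact: measurable_ziter_baker.
have miter (f : X -> X) n : mpres P2 P2 f -> mpres P2 P2 (iter n f).
  move=> [mf fE]; elim: n => [|n [mn nE]].
    by split => //; exact: measurable_id.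
  split; first exact: (measurableT_comp mf mn).
  move=> g bg /=; rewrite -[RHS](fE _ bg).
  by rewrite (nE _ (bmeas_comp bg mf)).
case: k => n; first exact: (miter _ n (mpres_baker R)).2.
exact: (miter _ n.+1 (mpres_unbaker R)).2.
Qed.

Lemma height_unit (y t : R) : 0 <= y < 1 -> height y t = Num.floor (y + t).
Proof. by move=> y01; rewrite /height (@floor_def _ y 0) ?subr0// add0r. Qed.

Lemma susp_unit (p : X) (y t : R) : 0 <= y < 1 ->
  susp t (p, y) = (ziter (@baker R) (@unbaker R) (Num.floor (y + t)) p, fpart (y + t)).
Proof.
move=> y01; rewrite /susp/= height_unit//.
by rewrite (@floor_def _ y 0) ?add0r.
Qed.

Lemma mpres_susp t : mpres cube cube (susp t).
Proof.
split; first exact: measurable_susp.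
move=> g bg; have bgs := bmeas_comp bg (measurable_susp t).
rewrite !mean_prodC//.
pose G (y : RR) := mean P2 (fun p => g (p, y)).
have bG : bmeas G := bmeas_mean2 P2 (unif R) bg.
rewrite -(mean_unif_rotation t bG).
apply: eq_mean_unif.
- exact: (bmeas_mean2 P2 (unif R) bgs).
- apply: (bmeas_comp (u := fun y : RR => fpart (y + t) : RR) bG).
  apply: measurableT_comp; first exact: measurable_fpart.
  exact: measurable_funD.
move=> y y01; rewrite /G -((mpres_ziter (Num.floor (y + t))).2 _ (bmeas_pair2 _ bg)).
by apply: eq_mean => p; rewrite susp_unit.
Qed.

End suspension.

(** * Ergodicity and correlations of the suspension *)

Section suspension_properties.
Context (R : realType).
Local Notation RR := (measurableTypeR R).
Local Notation X := (RR * RR)%type.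
Local Notation T := (X * RR)%type.
Local Notation P2 := (square R).
Local Notation zbaker := (ziter (@baker R) (@unbaker R)).

Definition walsh_lift (j : nat) (z : T) : R := walsh j z.1.1.

Lemma bmeas_walsh_fst j : bmeas (fun p : X => walsh j p.1).
Proof. by apply: (bmeas_comp (bmeas_walsh R j)); exact: measurable_fst. Qed.

Lemma bmeas_walsh_lift j : bmeas (walsh_lift j).
Proof. by apply: (bmeas_comp (bmeas_walsh_fst j)); exact: measurable_fst. Qed.

Lemma walsh_lift_norm j z : `|walsh_lift j z| = 1.
Proof. exact: walsh_norm. Qed.

Lemma mean_square_fst (f : RR -> R) : bmeas f ->
  mean P2 (fun p => f p.1) = mean (unif R) f.
Proof.
move=> bf; have := mean_prod_mul (unif R) (unif R) bf (bmeas_cst RR (1 : R)).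
by rewrite mean_cst mulr1 => <-; apply: eq_mean => p; rewrite mulr1.
Qed.

Lemma mean_cube_fst (f : X -> R) : bmeas f ->
  mean (cube R) (fun z => f z.1) = mean P2 f.
Proof.
move=> bf; have := mean_prod_mul P2 (unif R) bf (bmeas_cst RR (1 : R)).
by rewrite mean_cst mulr1 => <-; apply: eq_mean => p; rewrite mulr1.
Qed.

Lemma mean_walsh_lift j : mean (cube R) (walsh_lift j) = 0.
Proof.
rewrite (mean_cube_fst (bmeas_walsh_fst j)) mean_square_fst ?mean_walsh//.
exact: bmeas_walsh.
Qed.

Lemma zbaker_nat k (p : X) : in_square p ->
  in_square (zbaker (Posz k) p) /\ (zbaker (Posz k) p).1 = iter k (@dbl R) p.1.
Proof.
move=> Qp; elim: k => [//|k [Qk Ek]]; split; first exact: in_square_baker.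
by rewrite /= -Ek /baker ifT.
Qed.

Definition baker_corr i j (k : int) : R :=
  mean P2 (fun p => walsh i (zbaker k p).1 * walsh j p.1).

Lemma bmeas_baker_corr i j k :
  bmeas (fun p : X => walsh i (zbaker k p).1 * walsh j p.1).
Proof.
apply: bmeasM; last exact: bmeas_walsh_fst.
apply: (bmeas_comp (bmeas_walsh_fst i)); exact: measurable_ziter_baker.
Qed.

Lemma baker_corrE i j k : baker_corr i j (Posz k) =
  mean (unif R) (fun x => walsh i (iter k (@dbl R) x) * walsh j x).
Proof.
have bf : bmeas (fun x : RR => walsh i (iter k (@dbl R) x) * walsh j x).
  by apply: bmeasM; [exact: (bmeas_dbl k (bmeas_walsh R i))|exact: bmeas_walsh].
rewrite -mean_square_fst//; apply: eq_mean_square.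
- exact: bmeas_baker_corr.
- by apply: (bmeas_comp bf); exact: measurable_fst.
- by move=> p /(zbaker_nat k)[_ ->].
Qed.

Lemma baker_corr0 i j k : 0 <= k -> i != j \/ 0 < k -> baker_corr i j k = 0.
Proof. by case: k => // k _ h; rewrite baker_corrE mean_walsh_shift. Qed.

Lemma baker_corr1 j : baker_corr j j 0 = 1.
Proof.
rewrite baker_corrE -[RHS](mean_cst (unif R)); apply: eq_mean => x; exact: walsh_sqr.
Qed.

Lemma bmeas_walsh_lift_corr i j t : bmeas (fun z : T => walsh_lift i (susp t z) * walsh_lift j z).
Proof.
apply: bmeasM; last exact: bmeas_walsh_lift.
by apply: (bmeas_comp (bmeas_walsh_lift i)); exact: measurable_susp.
Qed.

Lemma mean_walsh_lift_corr i j t (c : RR -> R) : bmeas c ->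
    (forall y, 0 <= y < 1 -> baker_corr i j (Num.floor (y + t)) = c y) ->
  mean (cube R) (fun z => walsh_lift i (susp t z) * walsh_lift j z) = mean (unif R) c.
Proof.
move=> bc hc; have bij := bmeas_walsh_lift_corr i j t.
rewrite mean_prodC//; apply: eq_mean_unif => //.
  exact: (bmeas_mean2 P2 (unif R) bij).
move=> y y01; rewrite -hc//; apply: eq_mean => p.
by rewrite susp_unit.
Qed.

Lemma walsh_lift_orth i j (s t : R) : i != j \/ 1 <= `|s - t| ->
  mean (cube R) (fun z => walsh_lift i (susp s z) * walsh_lift j (susp t z)) = 0.
Proof.
wlog st : i j s t / t <= s => [wl h|].
  have [/wl->//|/ltW st] := leP t s.
  rewrite -(wl j i t s st); first by apply: eq_mean => z; rewrite mulrC.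
  by rewrite eq_sym distrC.
rewrite ger0_norm ?subr_ge0// => h.
have E : mean (cube R) (fun z => walsh_lift i (susp s z) * walsh_lift j (susp t z)) =
    mean (cube R) (fun z => walsh_lift i (susp (s - t) z) * walsh_lift j z).
  rewrite -((mpres_susp t).2 _ (bmeas_walsh_lift_corr i j (s - t))).
  by apply: eq_mean => z; rewrite -suspD subrK.
rewrite E (mean_walsh_lift_corr (bmeas_cst RR (0 : R))) ?mean_cst// => y y01.
apply: baker_corr0; first by rewrite floor_ge0; lra.
case: h => [ij|st1]; [by left|right].
by rewrite floor_gt0; lra.
Qed.

(** For [y] in [[0, 1)] the correlation is [1 - y], the measure of the heights
that do not reach the roof before time [y]. *)
Lemma walsh_lift_corr j : 4^-1 <=
  mean (unif R) (fun y => mean (cube R) (fun z => walsh_lift j (susp y z) * walsh_lift j z)).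
Proof.
pose low : RR -> R := \1_(`]-oo, 2^-1[%classic : set RR).
have blow : bmeas low by exact: bmeas_below.
have mlow : mean (unif R) low = 2^-1 by apply: mean_unif_below; lra.
have low_pos y : 0 <= low y by rewrite /low belowE; case: ifP.
have bjj : bmeas (fun q : RR * T => walsh_lift j (susp q.1 q.2) * walsh_lift j q.2).
  apply: bmeasM.
    apply: (bmeas_comp (bmeas_walsh_lift j)).
    have m : measurable_fun setT (fun q : RR * T => (q.2, q.1) : T * RR).
      by apply: measurable_fun_pair; [exact: measurable_snd|exact: measurable_fst].
    exact: (measurableT_comp (@measurable_susp2 R) m).
  by apply: (bmeas_comp (bmeas_walsh_lift j)); exact: measurable_snd.
have bcorr : bmeas (fun y : RR =>
    mean (cube R) (fun z => walsh_lift j (susp y z) * walsh_lift j z)).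
  exact: (bmeas_mean1 (unif R) (cube R) bjj).
have -> : 4^-1 = mean (unif R) (fun y => mean (unif R) low * low y).
  by rewrite meanZ// mlow; lra.
apply: le_mean_unif => // [|y y01]; first exact: bmeasZ.
have -> : mean (cube R) (fun z => walsh_lift j (susp y z) * walsh_lift j z) = 1 - y.
  rewrite -[RHS]mean_unif_below; last lra.
  apply: mean_walsh_lift_corr => [|u u01]; first exact: bmeas_below.
  rewrite belowE; case: ifPn => uy.
    by rewrite (@floor_def _ (u + y) 0) ?baker_corr1// add0r; lra.
  have u1 : 1 <= u + y by move: uy; rewrite -leNgt; lra.
  by rewrite baker_corr0 ?floor_ge0; [|lra|right; rewrite floor_gt0].
by rewrite mlow /low belowE; case: ifP => h; lra.
Qed.

(** Inside the cube an invariant set is a cylinder over its section at height [0],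
and this section is invariant under the baker map. *)
Lemma susp_ergodic : ergodic (cube R) (@susp R).
Proof.
move=> A mA invA.
pose A0 : set X := [set p | A (p, 0)].
have mA0 : measurable A0.
  have m : measurable_fun setT (fun p : X => (p, 0) : T) by exact: measurable_fun_pair.
  by have := m measurableT A mA; rewrite setTI.
have AE (p : X) (y : R) : 0 <= y < 1 -> A (p, y) <-> A0 p.
  move=> y01; rewrite /A0/= -[in A (p, 0)](invA y)/= susp_unit ?lexx ?ltr01// add0r.
  by rewrite /fpart (@floor_def _ y 0) ?add0r// subr0.
have invA0 (p : X) : A0 (baker p) <-> A0 p.
  rewrite /A0/= -[in A (p, 0)](invA 1)/= susp_unit ?lexx ?ltr01// add0r.
  by rewrite /fpart floor1/= subrr.
have PA : cube R A = P2 A0.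
  have bA : bmeas (\1_A : T -> R) by exact: bmeas_indic.
  rewrite -!mean_indic// mean_prod//; congr EFin; apply: eq_mean => p.
  rewrite -[RHS](mean_cst (unif R)); apply: eq_mean_unif.
  - exact: (bmeas_pair1 p bA).
  - exact: bmeas_cst.
  - move=> y y01; rewrite !indicE; congr (_%:R); congr nat_of_bool.
    have h := AE p y y01.
    by apply/idP/idP; rewrite !inE => /h.
have [A00|A01] := baker_ergodic mA0 invA0; [left|right].
  exact: etrans PA A00.
have := probability_setC (cube R) mA.
by rewrite PA A01 subee.
Qed.

End suspension_properties.


(** * The space as a standard Borel space *)

Section standard_borel_cube.
Context (R : realType).
Local Notation RR := (measurableTypeR R).
Local Notation T := (RR * RR * RR)%type.
Local Notation V := ('rV[R]_3).

Definition row_of (z : T) : V :=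
  \row_i (if i == 0 :> nat then z.1.1 else if i == 1%N :> nat then z.1.2 else z.2).

Definition unrow (v : V) : T :=
  (v 0 (@Ordinal 3 0 isT), v 0 (@Ordinal 3 1 isT), v 0 (@Ordinal 3 2 isT)).

Lemma row_ofK : cancel row_of unrow.
Proof. by move=> [[x y] z]; rewrite /unrow /row_of !mxE. Qed.

Lemma unrowK : cancel unrow row_of.
Proof.
move=> v; apply/rowP => -[[|[|[|//]]] i3]; rewrite /row_of /unrow !mxE/=;
  by congr (v 0 _); exact: val_inj.
Qed.

(** Boxes with rational corners, a countable basis of the topology. *)
Definition box (ab : {ffun 'I_3 -> rat * rat}) : set V :=
  [set v | forall i, ratr (ab i).1 < v 0 i < ratr (ab i).2].

Lemma box_open ab : open (box ab).
Proof.
rewrite openE => v hv; exists (fun _ j => `]ratr (ab j).1, ratr (ab j).2[%classic).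
  move=> i j; rewrite (ord1 i); apply: near_in_itvoo.
  by rewrite in_itv/=; exact: hv.
by move=> w hw i; have := hw 0 i; rewrite /= in_itv.
Qed.

Lemma box_basis (U : set V) v : nbhs v U -> exists ab, box ab v /\ box ab `<=` U.
Proof.
move=> [Q vQ QU].
have /choice[ab hab] : forall j : 'I_3, exists ab : rat * rat,
    ratr ab.1 < v 0 j < ratr ab.2 /\
    `]ratr ab.1, ratr ab.2[%classic `<=` Q 0 j.
  move=> j; have /nbhs_ballP[e /= e0 eQ] := vQ 0 j.
  have [q1] : exists q, ratr q \in `]v 0 j - e, v 0 j[ by apply: rat_in_itvoo; lra.
  have [q2] : exists q, ratr q \in `]v 0 j, v 0 j + e[ by apply: rat_in_itvoo; lra.
  rewrite !in_itv/= => /andP[q2v q2e] /andP[q1e q1v].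
  exists (q1, q2); split; first by rewrite q1v.
  move=> x; rewrite /= in_itv/= => /andP[x1 x2]; apply: eQ.
  by rewrite /ball/= ltr_distlC; lra.
exists [ffun j => ab j]; split => [j|w hw]; first by rewrite ffunE; case: (hab j).
apply: QU => i j; rewrite (ord1 i); apply: (hab j).2.
by rewrite /= in_itv/=; have := hw j; rewrite ffunE.
Qed.

Lemma open_box (U : set V) : open U ->
  U = \bigcup_(ab : {ffun 'I_3 -> rat * rat}) (if `[<box ab `<=` U>] then box ab else set0).
Proof.
move=> oU; apply/seteqP; split => [v Uv|v [ab _]]; last first.
  by case: asboolP => // abU /abU.
have [ab [abv abU]] := box_basis (open_nbhs_nbhs (conj oU Uv)).
by exists ab => //; case: asboolP.
Qed.

Lemma measurable_row_of_box ab : measurable (row_of @^-1` box ab).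
Proof.
have -> : row_of @^-1` box ab =
    (`]ratr (ab (@Ordinal 3 0 isT)).1, ratr (ab (@Ordinal 3 0 isT)).2[ `*`
     `]ratr (ab (@Ordinal 3 1 isT)).1, ratr (ab (@Ordinal 3 1 isT)).2[) `*`
     `]ratr (ab (@Ordinal 3 2 isT)).1, ratr (ab (@Ordinal 3 2 isT)).2[.
  apply/seteqP; split => [[[x y] z]|[[x y] z]] /=; rewrite !in_itv/=.
    move=> h; split; first split.
    - by have := h (@Ordinal 3 0 isT); rewrite mxE.
    - by have := h (@Ordinal 3 1 isT); rewrite mxE.
    - by have := h (@Ordinal 3 2 isT); rewrite mxE.
  move=> [[hx hy] hz] [[|[|[|//]]] i3]; rewrite mxE/=;
    by rewrite (bool_irrelevance i3 isT).
by apply: measurableX; [apply: measurableX|]; exact: measurable_itv.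
Qed.

Lemma standard_borel_cube : standard_borel R T.
Proof.
exists V, row_of; split.
- exact: norm_hausdorff.
- exists (range box); first exact: (sub_countable (card_image_le _ _) (countableP _)).
  split; first by move=> _ [ab _ <-]; exact: box_open.
  move=> v U /box_basis[ab [abv abU]]; exists (box ab); last exact: abU.
  by split; [exact: imageT|exact: abv].
- exact: Bijective row_ofK unrowK.
- apply/seteqP; split.
    pose VB := g_sigma_algebraType (@open V).
    have mc j : measurable_fun [set: VB] (fun v : VB => (v : V) 0 j : RR).
      apply: (measurability (@RGenInftyO.G R)).
        exact: RGenInftyO.measurableE.
      move=> _ [_ [a ->] <-]; rewrite setTI; apply: sub_sigma_algebra => /=.
      apply: (@open_comp _ _ (fun v : V => v 0 j)); last exact: interval_open.
      by move=> v _; exact: coord_continuous.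
    have mu : measurable_fun [set: VB] (unrow : VB -> T).
      by apply: measurable_fun_pair => //; apply: measurable_fun_pair.
    move=> A mA; exists (unrow @^-1` A).
      by have := mu measurableT A mA; rewrite setTI.
    by rewrite -comp_preimage; apply/seteqP; split => z; rewrite /= row_ofK.
  have sub : <<s @open V >> `<=` [set B | measurable (row_of @^-1` B)].
    apply: smallest_sub.
      split => /= [|B mB|F mF].
      + by rewrite preimage_set0.
      + rewrite setTD preimage_setC; exact: measurableC.
      + by rewrite preimage_bigcup; exact: bigcupT_measurable.
    move=> U oU /=; rewrite (open_box oU) preimage_bigcup.
    apply: countable_bigcupT_measurable => [|ab]; first exact: countableP.
    by case: asboolP => _; [exact: measurable_row_of_box|rewrite preimage_set0].
  by move=> _ [B sB <-]; exact: sub.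
Qed.

End standard_borel_cube.

Theorem mainTheorem5 (R : realType) :
  exists (d : measure_display) (T : measurableType d)
    (mu : {sigma_finite_measure set T -> \bar R}) (F : R -> T -> T),
    [/\ standard_borel R T, is_flow mu F, ergodic mu F,
        ~ approximately_transitive mu F & ~ property_B mu F].
Proof.
have susp_0 := @susp0 R; have susp_D := @suspD R.
have susp_m := @measurable_susp2 R; have susp_mp := @mpres_susp R.
eexists; eexists; exists (cube R), (@susp R); split.
- exact: standard_borel_cube.
- exact: mpres_is_flow.
- exact: susp_ergodic.
- apply: (mpres_not_approximately_transitive susp_0 susp_D susp_m susp_mp
    (phi := @walsh_lift R)).
  + exact: bmeas_walsh_lift.
  + by move=> j x; rewrite walsh_lift_norm.
  + exact: mean_walsh_lift.
  + exact: walsh_lift_orth.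
  + exact: walsh_lift_corr.
- exact: mpres_not_property_B.
Qed.
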